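(* Let $k$ be a field and $\mathbb{K}=k(q_{12},q_{13},q_{23})$ an extension, where $q_{12},q_{13},q_{23}$ are nonzero; put $q_{31}=q_{13}^{-1}$. Consider the coordinate ring of quantum affine $3$-space $$S_Q(V)=\mathbb{K}\langle v_1,v_2,v_3\mid v_2v_1=q_{12}v_1v_2,\ v_1v_3=q_{31}v_3v_1,\ v_3v_2=q_{23}v_2v_3\rangle.$$ Then $\mathrm{Aut}_{\mathbb{K}}S_Q(V)$ is exactly one of the following groups. (i) If all of $q_{12},q_{23},q_{31}$ equal $1$, then $\mathrm{Aut}_{\mathbb{K}}S_Q(V)=\mathrm{GL}_3(k)$. (Here $\mathbb{K}=k$ and $\mathrm{tr.deg}_k\mathbb{K}=0$.) (ii) If all of $q_{12},q_{23},q_{31}$ equal $-1$, then $\mathrm{Aut}_{\mathbb{K}}S_Q(V)$ is the subgroup of monomial matrices in $\mathrm{GL}_3(k)$. (Also, $\mathbb{K}=k$ and $\mathrm{tr.deg}_k\mathbb{K}=0$.) (iii) $\mathrm{Aut}_{\mathbb{K}}S_Q(V)=(\mathbb{K}^* )^3$ and $\mathrm{tr.deg}_k\mathbb{K}\le 3$ unless $q_{12}=q_{23}=q_{31}$, or $\{q_{12},q_{23},q_{31}\}=\{\pm1,c,c^{-1}\}$ (that is, $\{1,c,c^{-1}\}$ or $\{-1,c,c^{-1}\}$, as multisets) for some $c\in\mathbb{K}^*$. (iv) If $q_{12}=q_{23}=q_{31}\ne\pm1$, then $\mathrm{tr.deg}_k\mathbb{K}\le 1$ and $\mathrm{Aut}_{\mathbb{K}}S_Q(V)$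 is generated by all matrices in $\mathrm{GL}_3(\mathbb{K})$ of the forms $$\begin{bmatrix}0&a_{12}&0\\ 0&0&a_{23}\\ a_{31}&0&0\end{bmatrix},\qquad\begin{bmatrix}0&0&a_{13}\\ a_{21}&0&0\\ 0&a_{32}&0\end{bmatrix}.$$ (v) If $\{q_{12},q_{23},q_{31}\}=\{1,c,c^{-1}\}$ (as multisets) for some $c\ne1$, then $\mathrm{tr.deg}_k\mathbb{K}\le1$ and three cases arise: (a) if $q_{23}=1$ and $q_{12}=q_{31}^{-1}\neq1$, then $\mathrm{Aut}_{\mathbb{K}}S_Q(V)$ is the group of all matrices in $\mathrm{GL}_3(\mathbb{K})$ of the form $\begin{bmatrix}a_{11}&0&0\\ 0&a_{22}&a_{23}\\ 0&a_{32}&a_{33}\end{bmatrix}$; (b) if $q_{31}=1$ and $q_{12}=q_{23}^{-1}\ne1$, then it is the group of all matrices in $\mathrm{GL}_3(\mathbb{K})$ of the form $\begin{bmatrix}a_{11}&0&a_{13}\\ 0&a_{22}&0\\ a_{31}&0&a_{33}\end{bmatrix}$; (c) if $q_{12}=1$ and $q_{23}=q_{31}^{-1}\ne1$, then it is the group of all matrices in $\mathrm{GL}_3(\mathbb{K})$ of the form $\begin{bmatrix}a_{11}&a_{12}&0\\ a_{21}&a_{22}&0\\ 0&0&a_{33}\end{bmatrix}$. (vi) If $\{q_{12},q_{23},q_{31}\}=\{-1,c,c^{-1}\}$ (as multisets) for some $c\ne-1$ in $\mathbb{K}^*$, then $\mathrm{tr.deg}_k\mathbb{K}\le1$ and $\mathrm{Aut}_{\mathbb{K}}S_Q(V)$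 is generated by $(\mathbb{K}^* )^3$ together with all matrices in $\mathrm{GL}_3(\mathbb{K})$ of the form $$\begin{bmatrix}a_{11}&0&0\\ 0&0&a_{23}\\ 0&a_{32}&0\end{bmatrix}\ \text{if } q_{23}=-1,\ q_{12}=q_{31}^{-1};\qquad\begin{bmatrix}0&0&a_{13}\\ 0&a_{22}&0\\ a_{31}&0&0\end{bmatrix}\ \text{if } q_{31}=-1,\ q_{12}=q_{23}^{-1};\qquad\text{or}\quad\begin{bmatrix}0&a_{12}&0\\ a_{21}&0&0\\ 0&0&a_{33}\end{bmatrix}\ \text{if } q_{12}=-1,\ q_{31}^{-1}=q_{23}.$$ (The bounds on $\mathrm{tr.deg}_k\mathbb{K}$ are upper bounds, allowing further evaluation of the quantum parameters in addition to the given conditions on them.)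
   Context: $V$ is the $3$-dimensional $\mathbb{K}$-vector space with basis $v_1,v_2,v_3$. $\mathrm{Aut}_{\mathbb{K}}S_Q(V)$ denotes the group of graded $\mathbb{K}$-algebra automorphisms of $S_Q(V)$ (with each $v_i$ in degree $1$); restriction to the degree one part $V$ identifies it with a subgroup of $\mathrm{GL}_3(\mathbb{K})$ using the basis $v_1,v_2,v_3$. $(\mathbb{K}^* )^3$ denotes the group of invertible diagonal matrices. A matrix is monomial if each row and each column has exactly one nonzero entry. $\mathrm{tr.deg}_k\mathbb{K}$ is the transcendence degree of $\mathbb{K}$ over $k$.
   Formalization: Cases (ii) and (vi) are stated only when -1 ≠ 1 in K: in characteristic 2 they contradict (i) and (v) (e.g. all parameters 1 = -1 over F_2 gives GL_3, not the monomial matrices), and those parameters are covered by (i) and (v). *)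

(* Defs.v *)
From HB Require Import structures.
From mathcomp Require Import all_boot all_order all_algebra.
From mathcomp Require Import generic_quotient ring_quotient.
From mathcomp Require Import boolp classical_sets.
From mathcomp Require Import monalg mpoly.

Set Implicit Arguments.
Unset Strict Implicit.
Unset Printing Implicit Defensive.

Import GRing.Theory.

Local Open Scope ring_scope.
Local Open Scope classical_set_scope.
Local Open Scope quotient_scope.

Section FieldExtension.
Variables (k K : fieldType) (iota : {rmorphism k -> K}).

(* K = k(s): the only subfield of K containing k and s is K. *)
Definition generated_field (s : seq K) : Prop :=
  forall S : {pred K}, GRing.divring_closed S ->
    (forall a, iota a \in S) -> {in s, forall x, x \in S} ->
  forall x, x \in S.

Definition trivial_ext : Prop := forall x : K, exists a : k, iota a = x.

Definition alg_indep n (x : 'I_n -> K) : Prop :=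
  forall p : mpoly.mpoly n k, mpoly.mmap iota x p = 0 -> p = 0.

Definition is_trdeg (d : nat) : Prop :=
  (exists x : 'I_d -> K, alg_indep x) /\
  (forall m (x : 'I_m -> K), alg_indep x -> (m <= d)%N).

Definition trdeg_le (n : nat) : Prop := exists2 d, is_trdeg d & (d <= n)%N.

End FieldExtension.

Inductive two_sided_ideal (R : nzRingType) (rels : set R) : R -> Prop :=
| TSI_gen r : rels r -> two_sided_ideal rels r
| TSI_0 : two_sided_ideal rels 0
| TSI_D x y : two_sided_ideal rels x -> two_sided_ideal rels y ->
    two_sided_ideal rels (x + y)
| TSI_M a x b : two_sided_ideal rels x -> two_sided_ideal rels (a * x * b).

(* Indices of v_1, v_2, v_3, as 'I_3 starts at 0. *)
Definition i1 : 'I_3 := @Ordinal 3 0 isT.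
Definition i2 : 'I_3 := @Ordinal 3 1 isT.
Definition i3 : 'I_3 := @Ordinal 3 2 isT.

Section QuantumAffineSpace.
Variables (K : fieldType) (q12 q23 q31 : K).

Local Notation FA := {malg K[{fmonom 'I_3}]}.

Definition free_v (i : 'I_3) : FA := << fmu i >>.

Definition quantum_rels : set FA :=
  [set r | [\/ r = free_v i2 * free_v i1 - q12 *: (free_v i1 * free_v i2),
               r = free_v i1 * free_v i3 - q31 *: (free_v i3 * free_v i1)
             | r = free_v i3 * free_v i2 - q23 *: (free_v i2 * free_v i3)]].

Definition quantum_ideal : {pred FA} :=
  fun x => `[< two_sided_ideal quantum_rels x >].

Local Notation I := quantum_ideal.

Lemma quantum_idealP x : reflect (two_sided_ideal quantum_rels x) (x \in I).
Proof. exact: asboolP. Qed.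

Lemma quantum_idealM a x b : x \in I -> a * x * b \in I.
Proof. by move=> /quantum_idealP xI; apply/quantum_idealP/TSI_M. Qed.

Lemma quantum_ideal_zmod : GRing.zmod_closed I.
Proof.
split=> [|x y /quantum_idealP xI yI]; first exact/quantum_idealP/TSI_0.
apply/quantum_idealP/TSI_D => //; apply/quantum_idealP.
by rewrite -mulN1r -[_ * y]mulr1 quantum_idealM.
Qed.

HB.instance Definition _ := GRing.isZmodClosed.Build FA I quantum_ideal_zmod.

Lemma quantum_ideal1 : 1 \notin I.
Proof.
suff coef0 x : two_sided_ideal quantum_rels x -> monalg.mcoeff mone x = 0.
  by apply/negP => /quantum_idealP/coef0/eqP; rewrite monalg.mcoeff1 eqxx oner_eq0.
have v0 i : monalg.mcoeff mone (free_v i) = 0 :> K.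
  by rewrite monalg.mcoeffU1 -fdeg_eq0 fdegU.
have coefM y z : monalg.mcoeff mone (y * z : FA) =
    monalg.mcoeff mone y * monalg.mcoeff mone z.
  exact: (monalg.mcoeff1g_is_multiplicative _ _).1.
have rel0 i j c : monalg.mcoeff mone
    (free_v i * free_v j - c *: (free_v j * free_v i)) = 0.
  rewrite monalg.mcoeffB monalg.mcoeffZ.
  move: (v0 i) (v0 j); move: (free_v i) (free_v j) => u w u0 w0.
  by rewrite (coefM u w) (coefM w u) u0 w0 !mulr0 subr0.
elim=> {x} [r|||].
- by case=> ->; apply: rel0.
- exact: monalg.mcoeff0.
- by move=> x y _ x0 _ y0; rewrite monalg.mcoeffD x0 y0 addr0.
- by move=> a x b _ x0; rewrite coefM (coefM a) x0 mulr0 mul0r.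
Qed.

Definition SQ : Type := Quotient.quot I.

HB.instance Definition _ := GRing.Zmodule.on SQ.
HB.instance Definition _ := @EqQuotient.on SQ.

Lemma SQ_eqE (x y : FA) : (\pi_SQ x == \pi_SQ y :> SQ) = (x - y \in I).
Proof. by rewrite -Quotient.idealrBE. Qed.

Lemma SQ_repr (x : FA) : repr (\pi_SQ x) - x \in I.
Proof. by rewrite -SQ_eqE reprK. Qed.

Definition SQ_one : SQ := \pi_SQ 1.
Definition SQ_mul (x y : SQ) : SQ := \pi_SQ (repr x * repr y).
Definition SQ_scale (c : K) (x : SQ) : SQ := \pi_SQ (c *: repr x).

Lemma SQ_piM x y : \pi_SQ (x * y) = SQ_mul (\pi_SQ x) (\pi_SQ y).
Proof.
apply/esym/eqP; rewrite SQ_eqE.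
set x' := repr _; set y' := repr _.
have -> : x' * y' - x * y = 1 * (x' - x) * y' + x * (y' - y) * 1.
  by rewrite mul1r mulr1 mulrBl mulrBr addrA subrK.
by rewrite rpredD ?quantum_idealM ?SQ_repr.
Qed.

Lemma SQ_piZ c x : \pi_SQ (c *: x) = SQ_scale c (\pi_SQ x).
Proof.
apply/esym/eqP; rewrite SQ_eqE -scalerBr.
rewrite -[_ - x]mul1r scalerAl -[_ * _]mulr1.
exact/quantum_idealM/SQ_repr.
Qed.

Lemma SQ_piD (x y : FA) : \pi_SQ (x + y) = \pi_SQ x + \pi_SQ y :> SQ.
Proof. by rewrite !piE. Qed.

Lemma SQ_ind (P : SQ -> Prop) : (forall x, P (\pi_SQ x)) -> forall x, P x.
Proof. by move=> h x; rewrite -[x]reprK. Qed.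

Lemma SQ_mulA : associative SQ_mul.
Proof.
by elim/SQ_ind=> x; elim/SQ_ind=> y; elim/SQ_ind=> z; rewrite -!SQ_piM mulrA.
Qed.

Lemma SQ_mul1 : left_id SQ_one SQ_mul.
Proof. by elim/SQ_ind=> x; rewrite -SQ_piM mul1r. Qed.

Lemma SQ_mulr1 : right_id SQ_one SQ_mul.
Proof. by elim/SQ_ind=> x; rewrite -SQ_piM mulr1. Qed.

Lemma SQ_mulDl : left_distributive SQ_mul +%R.
Proof.
elim/SQ_ind=> x; elim/SQ_ind=> y; elim/SQ_ind=> z.
by rewrite -SQ_piD -!SQ_piM mulrDl SQ_piD.
Qed.

Lemma SQ_mulDr : right_distributive SQ_mul +%R.
Proof.
elim/SQ_ind=> x; elim/SQ_ind=> y; elim/SQ_ind=> z.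
by rewrite -SQ_piD -!SQ_piM mulrDr SQ_piD.
Qed.

Lemma SQ_one_neq0 : SQ_one != 0.
Proof.
have -> : (0 : SQ) = \pi_SQ 0 by rewrite !piE.
by rewrite SQ_eqE subr0 quantum_ideal1.
Qed.

HB.instance Definition _ := GRing.Zmodule_isNzRing.Build SQ
  SQ_mulA SQ_mul1 SQ_mulr1 SQ_mulDl SQ_mulDr SQ_one_neq0.

Lemma SQ_scaleA a b x : SQ_scale a (SQ_scale b x) = SQ_scale (a * b) x.
Proof. by elim/SQ_ind: x => x; rewrite -!SQ_piZ scalerA. Qed.

Lemma SQ_scale1 : left_id 1 SQ_scale.
Proof. by elim/SQ_ind=> x; rewrite -SQ_piZ scale1r. Qed.

Lemma SQ_scaleDr : right_distributive SQ_scale +%R.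
Proof.
by move=> a; elim/SQ_ind=> x; elim/SQ_ind=> y;
   rewrite -SQ_piD -!SQ_piZ scalerDr SQ_piD.
Qed.

Lemma SQ_scaleDl x : {morph SQ_scale^~ x : a b / a + b}.
Proof. by move=> a b; elim/SQ_ind: x => x; rewrite -!SQ_piZ scalerDl SQ_piD. Qed.

HB.instance Definition _ := GRing.Zmodule_isLmodule.Build K SQ
  SQ_scaleA SQ_scale1 SQ_scaleDr SQ_scaleDl.

Lemma SQ_scaleAl (a : K) (x y : SQ) : a *: (x * y) = (a *: x) * y.
Proof.
elim/SQ_ind: x => x; elim/SQ_ind: y => y.
by rewrite -[_ * _]SQ_piM -[LHS]SQ_piZ -[a *: _]SQ_piZ -[RHS]SQ_piM scalerAl.
Qed.

HB.instance Definition _ := GRing.Lmodule_isLalgebra.Build K SQ SQ_scaleAl.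

Lemma free_scaleAr (a : K) (x y : FA) : a *: (x * y) = x * (a *: y).
Proof.
apply/malgP => m; rewrite (monalg.mcoeffZ a (x * y) m) (monalg.mcoeffMl x y) mulr_sumr.
rewrite (monalg.mcoeffMl x (a *: y)); apply/eq_bigr => k1 _; rewrite mulr_sumr.
rewrite [RHS](finmap.big_fset_incl _ (monalg.msuppZ_le a y)) /=; last first.
  by move=> k2 _ /monalg.mcoeff_outdom->; rewrite mulr0 mul0rn.
by apply/eq_bigr => k2 _; rewrite monalg.mcoeffZ mulrnAr mulrCA.
Qed.

Lemma SQ_scaleAr (a : K) (x y : SQ) : a *: (x * y) = x * (a *: y).
Proof.
elim/SQ_ind: x => x; elim/SQ_ind: y => y.
by rewrite -[_ * _]SQ_piM -[LHS]SQ_piZ -[a *: _]SQ_piZ -[RHS]SQ_piM free_scaleAr.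
Qed.

HB.instance Definition _ := GRing.Lalgebra_isAlgebra.Build K SQ SQ_scaleAr.

Definition SQ_v (i : 'I_3) : SQ := \pi_SQ (free_v i).

Lemma SQ_rels :
  [/\ SQ_v i2 * SQ_v i1 = q12 *: (SQ_v i1 * SQ_v i2),
      SQ_v i1 * SQ_v i3 = q31 *: (SQ_v i3 * SQ_v i1)
    & SQ_v i3 * SQ_v i2 = q23 *: (SQ_v i2 * SQ_v i3)].
Proof.
have vM i j : SQ_v i * SQ_v j = \pi_SQ (free_v i * free_v j).
  exact/esym/SQ_piM.
have rel i j c : quantum_rels (free_v j * free_v i - c *: (free_v i * free_v j)) ->
    SQ_v j * SQ_v i = c *: (SQ_v i * SQ_v j).
  move=> hr; rewrite !vM; apply: etrans (SQ_piZ _ _).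
  by apply/eqP; rewrite SQ_eqE; apply/quantum_idealP/TSI_gen.
by split; apply: rel; [constructor 1 | constructor 2 | constructor 3].
Qed.

(* The degree n component is spanned by the products of n generators. *)
Definition homogeneous (n : nat) (x : SQ) : Prop :=
  exists c : n.-tuple 'I_3 -> K,
    x = \sum_(t : n.-tuple 'I_3) c t *: \prod_(i <- t) SQ_v i.

Definition graded_aut (phi : {lrmorphism SQ -> SQ}) : Prop :=
  bijective phi /\ forall n x, homogeneous n x -> homogeneous n (phi x).

(* Aut_K S_Q(V), seen inside GL_3(K) by restriction to degree one: column j
   of M holds the coordinates of phi (v_j), so composition of automorphisms
   is the product of matrices. *)
Definition AutSQ : set 'M[K]_3 :=
  [set M | exists2 phi : {lrmorphism SQ -> SQ}, graded_aut phi &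
     forall j, phi (SQ_v j) = \sum_i M i j *: SQ_v i].

End QuantumAffineSpace.

Section MatrixGroups.

Definition GLset (K : fieldType) : set 'M[K]_3 := [set M | M \in unitmx].

Definition monomial_set (K : fieldType) : set 'M[K]_3 :=
  [set M | (forall i, exists! j, M i j != 0) /\
           (forall j, exists! i, M i j != 0)].

(* (K^* )^3 *)
Definition torus (K : fieldType) : set 'M[K]_3 :=
  [set M | is_diag_mx M /\ M \in unitmx].

Inductive generated (K : fieldType) (X : set 'M[K]_3) : set 'M[K]_3 :=
| Gen_in M : X M -> generated X M
| Gen_1 : generated X 1%:M
| Gen_M M N : generated X M -> generated X N -> generated X (M *m N)
| Gen_V M : generated X M -> generated X (invmx M).

Definition mx3 (K : fieldType) (a11 a12 a13 a21 a22 a23 a31 a32 a33 : K) :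
    'M[K]_3 :=
  \matrix_(i, j) nth 0 (nth [::] [:: [:: a11; a12; a13];
                                     [:: a21; a22; a23];
                                     [:: a31; a32; a33]] i) j.

End MatrixGroups.

Arguments GLset : clear implicits.
Arguments monomial_set : clear implicits.
Arguments torus : clear implicits.

(* Equality of {q12, q23, q31} and {e, c, 1/c} as multisets. *)
Definition multiset_eq (K : fieldType) (q12 q23 q31 e c : K) : Prop :=
  perm_eq [:: q12; q23; q31] [:: e; c; c^-1].

Section Cases.
Variables (K : fieldType) (q12 q23 q31 : K).

Definition case_i : Prop := [/\ q12 = 1, q23 = 1 & q31 = 1].

(* In characteristic 2, where -1 = 1, parameters all equal to -1 belong to
   case_i, and {-1, c, 1/c} belongs to case_v (or case_i): case_ii and case_vi
   are about -1 distinct from 1. *)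
Definition case_ii : Prop :=
  (-1 : K) != 1 /\ [/\ q12 = -1, q23 = -1 & q31 = -1].

Definition case_iii : Prop :=
  ~ (q12 = q23 /\ q23 = q31) /\
  ~ (exists2 c : K, c != 0 &
      multiset_eq q12 q23 q31 1 c \/ multiset_eq q12 q23 q31 (-1) c).

Definition case_iv : Prop :=
  [/\ q12 = q23, q23 = q31, q12 != 1 & q12 != -1].

Definition case_v : Prop :=
  exists c : K, [/\ c != 0, c != 1 & multiset_eq q12 q23 q31 1 c].

Definition case_vi : Prop :=
  (-1 : K) != 1 /\
  exists c : K, [/\ c != 0, c != -1 & multiset_eq q12 q23 q31 (-1) c].

End Cases.

(* Main.v *)
Require Import Defs.
From HB Require Import structures.
From mathcomp Require Import all_boot all_order all_algebra.
From mathcomp Require Import generic_quotient.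
From mathcomp Require Import boolp classical_sets.
From mathcomp Require Import monalg mpoly.
From mathcomp Require Import perm ring.

(* Write the relations as v_j v_i = p_ij v_i v_j.  A matrix M in GL_3 extends to
   an automorphism iff X |-> M X M^T preserves the 3-dimensional space of
   quadratic relations, and comparing coefficients of the monomials v_a v_b this
   amounts to: p_ab = p_ij whenever M_ai and M_bj are nonzero.  As some
   permutation s has all M_(s j) j nonzero, s is a symmetry of the array p, and
   every further nonzero entry M_aj makes the indices a and s j indistinguishable
   for p; the six cases are read off from the possible symmetries of three
   indices.  The bounds on the transcendence degree come from counting monomials:
   a field generated by n elements has too few polynomial values of bounded
   degree to contain n + 1 algebraically independent elements. *)

Set Implicit Arguments.
Unset Strict Implicit.
Unset Printing Implicit Defensive.

Import GRing.Theory.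

Local Open Scope ring_scope.
Local Open Scope quotient_scope.

(** * Transcendence degree of finitely generated extensions *)

(** Passing from an automorphism to a condition on its matrix requires that S_Q(V) has no quadratic
    relations beyond the imposed ones. No monomial basis of the algebra is constructed for this:
    each coefficient is detected by a homomorphism to 4 x 4 matrices, and the linear independence of
    the generators follows after multiplying by one of them. Conversely, the universal property
    turns a matrix preserving the relations into an endomorphism; finite dimension of the relation
    space makes the inverse matrix preserve it as well, and the grading is respected automatically
    because generators go to linear forms. Characteristic 2 shapes several formulations: a diagonal
    coefficient must never be deduced to vanish from twice it being zero, and the cases built on -1
    have to be kept apart from those built on 1. [is_trdeg] asks for a largest size of an
    independent family, so every family has to be bounded; the counting argument does this without
    an exchange property. *)

Section TranscendenceDegree.
Variables (k K : fieldType) (iota : {rmorphism k -> K}).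

Section BoundedSpan.
Variables (n : nat) (y : 'I_n -> K).

(** The bound [D] applies to each exponent separately, not to the total degree, so there are exactly
    [D.+1 ^ n] exponent vectors to count. *)
Definition bounded_span (D : nat) (x : K) : Prop :=
  exists c : {ffun 'I_n -> 'I_D.+1} -> k,
    x = \sum_f iota (c f) * \prod_i y i ^+ f i.

Lemma bounded_span0 D : bounded_span D 0.
Proof. by exists (fun=> 0); rewrite big1 // => f _; rewrite rmorph0 mul0r. Qed.

Lemma bounded_spanD D x z :
  bounded_span D x -> bounded_span D z -> bounded_span D (x + z).
Proof.
move=> [c ->] [d ->]; exists (fun f => c f + d f); rewrite -big_split /=.
by apply: eq_bigr => f _; rewrite rmorphD mulrDl.
Qed.

Lemma bounded_spanZ D a x : bounded_span D x -> bounded_span D (iota a * x).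
Proof.
move=> [c ->]; exists (fun f => a * c f); rewrite mulr_sumr.
by apply: eq_bigr => f _; rewrite rmorphM mulrA.
Qed.

Lemma bounded_span_sum D (T : finType) (F : T -> K) :
  (forall t, bounded_span D (F t)) -> bounded_span D (\sum_t F t).
Proof.
move=> hF; elim/big_ind: _ => //; [exact: bounded_span0 | exact: bounded_spanD].
Qed.

Lemma bounded_span_monomial D (e : 'I_n -> nat) :
  (forall i, e i <= D)%N -> bounded_span D (\prod_i y i ^+ e i).
Proof.
move=> he; pose f : {ffun 'I_n -> 'I_D.+1} := [ffun i => inord (e i)].
exists (fun g => (g == f)%:R); rewrite (bigD1 f) //= eqxx rmorph1 mul1r.
rewrite [X in _ + X]big1 => [|g /negPf->]; last by rewrite rmorph0 mul0r.
by rewrite addr0; apply: eq_bigr => i _; rewrite ffunE inordK ?ltnS.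
Qed.

Lemma bounded_span_le D E x : (D <= E)%N -> bounded_span D x -> bounded_span E x.
Proof.
move=> leDE [c ->]; apply: bounded_span_sum => f; apply/bounded_spanZ.
by apply: bounded_span_monomial => i; apply: leq_trans leDE; rewrite -ltnS.
Qed.

Lemma bounded_spanM D E x z :
  bounded_span D x -> bounded_span E z -> bounded_span (D + E) (x * z).
Proof.
move=> [c ->] [d ->]; rewrite mulr_suml; apply: bounded_span_sum => f.
rewrite mulr_sumr; apply: bounded_span_sum => g.
rewrite mulrACA -rmorphM -big_split /=; apply/bounded_spanZ.
under eq_bigr => i _ do rewrite -exprD.
by apply: bounded_span_monomial => i; rewrite leq_add // -ltnS.
Qed.

Lemma bounded_span1 D : bounded_span D 1.
Proof.
have := @bounded_span_monomial D (fun=> 0%N); rewrite big1 // => h; exact: h.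
Qed.

Lemma bounded_spanX D e x : bounded_span D x -> bounded_span (e * D) (x ^+ e).
Proof.
move=> hx; elim: e => [|e IHe]; first exact: bounded_span1.
by rewrite exprS mulSn; apply: bounded_spanM.
Qed.

Lemma bounded_span_prod (T : finType) D (F : T -> K) :
  (forall t, bounded_span D (F t)) ->
  bounded_span (#|T| * D) (\prod_t F t).
Proof.
move=> hF; rewrite -[X in (X * _)%N]sum1_card big_distrl /=.
elim/big_rec2: _ => [|t E x _ hx]; first exact: bounded_span1.
by rewrite mul1n; apply: bounded_spanM.
Qed.

(** Coordinates of the [F t] in the spanning monomials form a matrix with more rows than columns; a
    nonzero row vector in its left kernel is the dependence. *)
Lemma bounded_span_dep D (T : finType) (F : T -> K) :
    (forall t, bounded_span D (F t)) -> (D.+1 ^ n < #|T|)%N ->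
  exists u : T -> k, (exists t, u t != 0) /\ \sum_t iota (u t) * F t = 0.
Proof.
move=> /choice[c hc] ltT.
pose A := \matrix_(i < #|T|, j < #|{: {ffun 'I_n -> 'I_D.+1}}|)
  c (enum_val i) (enum_val j).
have : kermx A != 0.
  rewrite -mxrank_eq0 mxrank_ker subn_eq0 -ltnNge.
  by apply: leq_ltn_trans (rank_leq_col A) _; rewrite card_ffun !card_ord.
case/rowV0Pn => v /sub_kermxP vA v0.
exists (fun t => v 0 (enum_rank t)); split.
  have [/existsP[t ht]|/existsPn h] := boolP [exists t, v 0 (enum_rank t) != 0].
    by exists t.
  case/eqP: v0; apply/rowP => i; rewrite mxE -[i]enum_valK.
  by apply/eqP; rewrite -[_ == _]negbK h.
transitivity (\sum_f iota ((v *m A) 0 (enum_rank f)) * \prod_i y i ^+ f i);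
  last by rewrite big1 // => f _; rewrite vA mxE rmorph0 mul0r.
under eq_bigr => t _ do rewrite hc mulr_sumr.
rewrite exchange_big; apply: eq_bigr => f _ /=.
rewrite mxE rmorph_sum mulr_suml /= (reindex enum_rank) /=; last first.
  by apply: onW_bij; exact: enum_rank_bij.
by apply: eq_bigr => t _; rewrite mxE !enum_rankK mulrA rmorphM.
Qed.

Definition poly_value (x : K) : Prop := exists D, bounded_span D x.

Lemma poly_value_rat a : poly_value (iota a).
Proof.
by exists 0%N; rewrite -[iota a]mulr1; apply/bounded_spanZ/bounded_span1.
Qed.

Lemma poly_valueD x z : poly_value x -> poly_value z -> poly_value (x + z).
Proof.
move=> [D hx] [E hz]; exists (D + E)%N; apply: bounded_spanD.
  by apply: bounded_span_le hx; apply: leq_addr.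
by apply: bounded_span_le hz; apply: leq_addl.
Qed.

Lemma poly_valueM x z : poly_value x -> poly_value z -> poly_value (x * z).
Proof. by move=> [D hx] [E hz]; exists (D + E)%N; apply: bounded_spanM. Qed.

Lemma poly_valueB x z : poly_value x -> poly_value z -> poly_value (x - z).
Proof.
move=> hx hz; apply: poly_valueD => //; rewrite -mulN1r.
by apply: poly_valueM => //; rewrite -(rmorph1 iota) -rmorphN; apply: poly_value_rat.
Qed.

Lemma poly_value_gen i : poly_value (y i).
Proof.
exists 1%N; have := @bounded_span_monomial 1 (fun j => j == i).
rewrite (bigD1 i) //= eqxx big1 ?mulr1 => [h|j /negPf->]; last exact: expr0.
by rewrite -[y i]expr1; apply: h => j; case: (j == i).
Qed.

Definition frac_value (x : K) : Prop :=
  exists p q, [/\ poly_value p, poly_value q, q != 0 & x = p / q].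

Lemma frac_value_poly x : poly_value x -> frac_value x.
Proof.
move=> hx; exists x, 1; split; rewrite ?oner_neq0 ?divr1 //.
by rewrite -(rmorph1 iota); apply: poly_value_rat.
Qed.

Lemma frac_value_closed : GRing.divring_closed (fun x => `[< frac_value x >]).
Proof.
split=> [|x z /asboolP[p [q [hp hq q0 ->]]] /asboolP[r [t [hr ht t0 ->]]]|
  x z /asboolP[p [q [hp hq q0 ->]]] /asboolP[r [t [hr ht t0 ->]]]]; apply/asboolP.
- by apply: frac_value_poly; rewrite -(rmorph1 iota); apply: poly_value_rat.
- exists (p * t - r * q), (q * t); split; rewrite ?mulf_neq0 //.
  + by apply: poly_valueB; apply: poly_valueM.
  + exact: poly_valueM.
  + by rewrite -mulNr addf_div // mulNr.
(* [divring_closed] includes division by zero, where the inverse of [0] is [0]. *)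
- have [->|r0] := eqVneq r 0.
    rewrite mul0r invr0 mulr0; apply: frac_value_poly.
    by rewrite -(rmorph0 iota); apply: poly_value_rat.
  exists (p * t), (q * r); split; rewrite ?mulf_neq0 //; try exact: poly_valueM.
  by rewrite invf_div mulf_div.
Qed.

(* With x i = p i / q and all p i, q of degree at most D, the N ^ m monomials
   in x of degree less than N in each variable become, after multiplication by
   q ^ (m N), elements of a span of (m N D + 1) ^ n monomials in y; this is too
   small for large N when n < m. *)
Lemma alg_indep_frac m (x : 'I_m -> K) :
  (forall i, frac_value (x i)) -> alg_indep iota x -> (m <= n)%N.
Proof.
move=> /choice[p /choice[q hpq]] indx; rewrite leqNgt; apply/negP => ltnm.
(* A common denominator: multiplying [x i] by it cancels [q i] and leaves a polynomial value. *)
pose Q := \prod_i q i.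
have Q0 : Q != 0 by apply/prodf_neq0 => i _; have [] := hpq i.
have polyprod (P : pred 'I_m) : poly_value (\prod_(i | P i) q i).
  elim/big_ind: _ => [|u v|i _]; last by have [] := hpq i.
  - by rewrite -(rmorph1 iota); apply: poly_value_rat.
  - exact: poly_valueM.
have [DQ hDQ] : poly_value Q by exact: polyprod.
have /choice[d hd] i : poly_value (x i * Q).
  have [hp hq q0 ->] := hpq i; rewrite /Q (bigD1 i) //= mulrA divfK //.
  by apply: poly_valueM => //; apply: polyprod.
pose D := (DQ + \sum_i d i)%N.
have bQ : bounded_span D Q by apply: bounded_span_le hDQ; apply: leq_addr.
have bx i : bounded_span D (x i * Q).
  apply: bounded_span_le (hd i).
  by rewrite /D (bigD1 i) //= addnA [(DQ + _)%N]addnC -addnA leq_addr.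
(* Chosen so that N ^ m >= N ^ (n + 1) > (N (m D + 1)) ^ n >= (m N D + 1) ^ n. *)
pose N := ((m * D).+1 ^ n).+1.
pose F (e : {ffun 'I_m -> 'I_N}) := (\prod_i x i ^+ e i) * Q ^+ (m * N).
have hF e : bounded_span (m * (N * D)) (F e).
  (* The factor [Q ^+ (m * N)] is shared out as [Q ^+ N] per variable, of which [e i] copies clear
     the denominator of [x i ^+ e i]. *)
  have -> : F e = \prod_i ((x i * Q) ^+ e i * Q ^+ (N - e i)).
    rewrite /F [in LHS]mulnC exprM -[X in _ ^+ X]card_ord -prodr_const -big_split.
    apply: eq_bigr => i _ /=; rewrite exprMn -mulrA -exprD subnKC //.
    exact: ltnW.
  rewrite -[X in bounded_span (X * _)]card_ord; apply: bounded_span_prod => i.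
  have -> : (N * D = e i * D + (N - e i) * D)%N.
    by rewrite -mulnDl subnKC // ltnW.
  by apply: bounded_spanM; apply: bounded_spanX.
have [|u [[e ue] Hu]] := bounded_span_dep hF.
  rewrite card_ffun !card_ord; apply: (@leq_trans (N ^ n.+1)); last first.
    exact: leq_pexp2l.
  apply: (@leq_ltn_trans ((N * (m * D).+1) ^ n)).
    have [->|n0] := posnP n; first by rewrite !expn0.
    by rewrite leq_exp2r // mulnS mulnCA -add1n leq_add2r.
  by rewrite expnMn expnS mulnC ltn_pmul2r // expn_gt0.
pose X (e : {ffun 'I_m -> 'I_N}) : 'X_{1..m} := [multinom (e i : nat) | i < m].
pose P : mpoly.mpoly m k := \sum_e u e *: 'X_[X e].
have : P = 0.
  apply: indx; rewrite /P raddf_sum /=.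
  suff : Q ^+ (m * N) * \sum_i mmap iota x (u i *: 'X_[X i]) = 0.
    by move/eqP; rewrite mulf_eq0 expf_eq0 (negPf Q0) andbF => /eqP.
  apply: etrans Hu; rewrite mulr_sumr; apply: eq_bigr => f _.
  rewrite mmapZ mmapX mulrCA; congr (_ * _); rewrite mulrC; congr (_ * _).
  by apply: eq_bigr => i _; rewrite mnmE.
(* Distinct exponent functions give distinct multinomials, so the coefficient of [P] at [X e] is
   [u e], which is nonzero. *)
move/(congr1 (fun R => R@_(X e))); rewrite mcoeff0 raddf_sum /= (bigD1 e) //=.
rewrite mcoeffZ mcoeffX eqxx mulr1 big1 ?addr0 => [/eqP|f nfe].
  by rewrite (negPf ue).
rewrite mcoeffZ mcoeffX; have [eqX|_] := eqVneq (X f) (X e); last by rewrite mulr0.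
case/eqP: nfe; apply/ffunP => i; apply: val_inj.
by have := congr1 (fun M : 'X_{1..m} => M i) eqX; rewrite !mnmE.
Qed.

End BoundedSpan.

Lemma alg_indep_generated (s : seq K) m (x : 'I_m -> K) :
  generated_field iota s -> alg_indep iota x -> (m <= size s)%N.
Proof.
move=> gen; apply: (@alg_indep_frac _ (fun i : 'I_(size s) => s`_i)) => i.
apply/asboolP; apply: (gen _ (frac_value_closed _)) => [a|z /(nthP 0)[j ltj <-]].
  by apply/asboolP/frac_value_poly/poly_value_rat.
by apply/asboolP/frac_value_poly/(poly_value_gen (fun i => s`_i) (Ordinal ltj)).
Qed.

(** Polynomials in no variables are constants and [iota] is injective. This makes 0 an admissible
    size, so that a largest one exists. *)
Lemma alg_indep0 (x : 'I_0 -> K) : alg_indep iota x.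
Proof.
move=> p; rewrite (mpolyE p) raddf_sum /=.
have m0 (m : 'X_{1..0}) : m = 0%MM by apply/mnmP; case.
rewrite (eq_bigr (fun m => iota (p@_m))) => [|m _]; last first.
  by rewrite mmapZ mmapX (m0 m) mmap11 mulr1.
rewrite -rmorph_sum => /eqP; rewrite fmorph_eq0 => /eqP sum0.
rewrite (eq_bigr (fun m => p@_m *: 'X_[0%MM])) => [|m _]; last first.
  by rewrite [in 'X_[_]](m0 m).
by rewrite -scaler_suml sum0 scale0r.
Qed.

Lemma trdeg_le_generated (s : seq K) :
  generated_field iota s -> trdeg_le iota (size s).
Proof.
move=> gen; pose P d := `[< exists x : 'I_d -> K, alg_indep iota x >].
have exP : exists d, P d.
  by exists 0%N; apply/asboolP; exists (fun=> 0); apply: alg_indep0.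
have ubP d : P d -> (d <= size s)%N.
  by move/asboolP => [x]; apply: alg_indep_generated.
have [d /asboolP Pd maxd] := ex_maxnP exP ubP; exists d; last first.
  by apply: ubP; apply/asboolP.
by split=> // m x hx; apply: maxd; apply/asboolP; exists x.
Qed.

Lemma trdeg_trivial : generated_field iota [::] -> is_trdeg iota 0.
Proof.
move=> gen; split; first by exists (fun=> 0); apply: alg_indep0.
by move=> m x; exact: (alg_indep_generated gen).
Qed.

Lemma generated_field_sub (s t : seq K) :
    generated_field iota s ->
    (forall S : {pred K}, GRing.divring_closed S -> (forall a, iota a \in S) ->
      {in t, forall x, x \in S} -> {in s, forall x, x \in S}) ->
  generated_field iota t.
Proof. by move=> gen sub S S1 Sk St; apply: gen => //; apply: sub. Qed.

(** The image of [iota] is itself closed under subtraction and division. *)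
Lemma generated_field_nil_trivial : generated_field iota [::] -> trivial_ext iota.
Proof.
move=> gen x; apply/asboolP.
apply: (gen (fun z => `[< exists a, iota a = z >])) => [|a|//].
  2: by apply/asboolP; exists a.
split=> [|? ? /asboolP[a <-] /asboolP[b <-]|? ? /asboolP[a <-] /asboolP[b <-]];
  apply/asboolP.
- by exists 1; rewrite rmorph1.
- by exists (a - b); rewrite rmorphB.
- by exists (a / b); rewrite fmorph_div.
Qed.

End TranscendenceDegree.

(** * The universal property of S_Q(V) *)

Section FreeLift.
Variables (K : fieldType) (A : algType K) (x : 'I_3 -> A).

Local Notation FA := {malg K[{fmonom 'I_3}]}.

Definition word_value (m : {fmonom 'I_3}) : A := \prod_(i <- m) x i.

Lemma word_value_mmorphism : mmorphism word_value.
Proof.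
by split=> [m n|]; rewrite /word_value ?fmM ?big_cat // fm1 big_nil.
Qed.

HB.instance Definition _ := monalg.isMultiplicative.Build {fmonom 'I_3} A
  word_value word_value_mmorphism.

Definition free_lift (y : FA) : A := monalg.mmap (in_alg A) word_value y.

Lemma free_liftD : {morph free_lift : y z / y + z}.
Proof. by move=> y z; rewrite /free_lift monalg.mmapD. Qed.

Lemma free_liftB : {morph free_lift : y z / y - z}.
Proof. by move=> y z; rewrite /free_lift monalg.mmapB. Qed.

Lemma free_liftZ c y : free_lift (c *: y) = c *: free_lift y.
Proof. by rewrite /free_lift monalg.mmapZ mulr_algl. Qed.

Lemma free_lift_multiplicative : multiplicative free_lift.
Proof.
apply: monalg.commr_mmap_is_multiplicative => g m n.
by rewrite /GRing.comm mulr_algl mulr_algr.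
Qed.

Lemma free_liftM y z : free_lift (y * z) = free_lift y * free_lift z.
Proof. exact: free_lift_multiplicative.1. Qed.

Lemma free_lift1 : free_lift 1 = 1.
Proof. exact: free_lift_multiplicative.2. Qed.

Lemma free_lift_v i : free_lift (free_v K i) = x i.
Proof.
rewrite /free_lift /free_v monalg.mmapU /= scale1r mul1r /word_value.
by rewrite fmU big_seq1.
Qed.

Lemma free_lift_vM i j :
  free_lift (free_v K i * free_v K j) = x i * x j.
Proof. by rewrite (free_liftM (free_v K i)) !free_lift_v. Qed.

End FreeLift.

Section QuantumLift.
Variables (K : fieldType) (q12 q23 q31 : K) (A : algType K) (x : 'I_3 -> A).
Hypothesis x_rels : [/\ x i2 * x i1 = q12 *: (x i1 * x i2),
  x i1 * x i3 = q31 *: (x i3 * x i1) & x i3 * x i2 = q23 *: (x i2 * x i3)].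

Local Notation FA := {malg K[{fmonom 'I_3}]}.
Local Notation SQ := (SQ q12 q23 q31).
Local Notation v := (SQ_v q12 q23 q31).

Lemma free_lift_ideal y : y \in quantum_ideal q12 q23 q31 -> free_lift x y = 0.
Proof.
have [h1 h2 h3] := x_rels.
have rel0 i j c : x i * x j = c *: (x j * x i) ->
    free_lift x (free_v K i * free_v K j - c *: (free_v K j * free_v K i)) = 0.
  move=> h; rewrite free_liftB free_liftZ.
  move: (free_lift_vM x i j) (free_lift_vM x j i).
  move: (free_v K i * free_v K j) (free_v K j * free_v K i) => u w -> ->.
  by rewrite h subrr.
move/quantum_idealP; elim=> {y} [r|||].
- by case=> ->; apply: rel0.
- exact: monalg.mmap0.
- by move=> y z _ y0 _ z0; rewrite free_liftD y0 z0 addr0.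
- by move=> a y b _ y0; rewrite free_liftM (free_liftM x a) y0 mulr0 mul0r.
Qed.

(** Evaluation at a chosen representative; [free_lift_ideal] makes the choice irrelevant. *)
Definition quantum_lift (s : SQ) : A := free_lift x (repr s).

Lemma quantum_lift_pi y : quantum_lift (\pi_SQ y) = free_lift x y.
Proof.
apply/eqP; rewrite -subr_eq0 -free_liftB; apply/eqP/free_lift_ideal.
exact: SQ_repr.
Qed.

Lemma quantum_lift_additive : additive quantum_lift.
Proof.
elim/SQ_ind=> y; elim/SQ_ind=> z.
have -> : \pi_SQ y - \pi_SQ z = \pi_SQ (y - z) by rewrite !piE.
by rewrite !quantum_lift_pi free_liftB.
Qed.

Lemma quantum_lift_multiplicative : multiplicative quantum_lift.
Proof.
split=> [|]; last by rewrite -[1]/(SQ_one _ _ _) quantum_lift_pi free_lift1.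
elim/SQ_ind=> y; elim/SQ_ind=> z.
by rewrite -[_ * _]SQ_piM !quantum_lift_pi free_liftM.
Qed.

Lemma quantum_lift_scalable : scalable quantum_lift.
Proof.
move=> c; elim/SQ_ind=> y.
by rewrite -[c *: \pi_SQ y]SQ_piZ !quantum_lift_pi free_liftZ.
Qed.

HB.instance Definition _ := GRing.isAdditive.Build SQ A
  quantum_lift quantum_lift_additive.
HB.instance Definition _ := GRing.isMultiplicative.Build SQ A
  quantum_lift quantum_lift_multiplicative.
HB.instance Definition _ := GRing.isScalable.Build K SQ A *:%R
  quantum_lift quantum_lift_scalable.

(** Used with two targets: S_Q(V) itself, to build automorphisms, and 4 x 4 matrices, to detect
    quadratic coefficients. *)
Lemma SQ_universal : exists phi : {lrmorphism SQ -> A}, forall i, phi (v i) = x i.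
Proof.
by exists quantum_lift => i /=; rewrite quantum_lift_pi free_lift_v.
Qed.

End QuantumLift.

Lemma ord3_ind (P : 'I_3 -> Prop) : P i1 -> P i2 -> P i3 -> forall i, P i.
Proof.
move=> P1 P2 P3 [[|[|[|//]]] i].
- by rewrite (_ : Ordinal i = i1) //; apply: val_inj.
- by rewrite (_ : Ordinal i = i2) //; apply: val_inj.
- by rewrite (_ : Ordinal i = i3) //; apply: val_inj.
Qed.

Lemma sum_ord3 (V : nmodType) (F : 'I_3 -> V) : \sum_i F i = F i1 + F i2 + F i3.
Proof.
rewrite !big_ord_recl big_ord0 addr0 addrA.
by congr (F _ + F _ + F _); apply: val_inj.
Qed.

(** Off-diagonal terms cancel in pairs. The diagonal has its own hypothesis because a sign rule
    would not kill it in characteristic 2. *)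
Lemma sum_alternating (V : zmodType) (F : 'I_3 -> 'I_3 -> V) :
  (forall i, F i i = 0) -> (forall i j, i != j -> F j i = - F i j) ->
  \sum_i \sum_j F i j = 0.
Proof.
move=> F0 FN; rewrite !sum_ord3 !F0 add0r !addr0.
rewrite (FN i1 i2) // (FN i1 i3) // (FN i2 i3) //.
by rewrite addrACA !addrK subrr.
Qed.

Section SQTheory.
Variables (K : fieldType) (q12 q23 q31 : K).

Local Notation FA := {malg K[{fmonom 'I_3}]}.
Local Notation SQ := (SQ q12 q23 q31).
Local Notation v := (SQ_v q12 q23 q31).

Lemma SQ_pi_word (m : {fmonom 'I_3}) :
  \pi_SQ (<< m >> : FA) = \prod_(i <- m) v i.
Proof.
case: m => s; elim: s => [|i s IHs] /=.
  by rewrite big_nil -fmoneE.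
rewrite big_cons -IHs -[RHS]SQ_piM; congr (\pi_SQ _).
apply: etrans (esym (fgmulUU _ _ _ _)); rewrite mulr1; congr mkmalgU.
by apply: val_inj; rewrite /= fmM fmU.
Qed.

Lemma SQ_pi_sum (y : FA) :
  \pi_SQ y = \sum_(m <- finmap.enum_fset (monalg.msupp y))
    monalg.mcoeff m y *: \prod_(i <- m) v i.
Proof.
rewrite {1}[y]monalgE (big_morph _ (@SQ_piD _ _ _ _) (erefl (\pi_SQ 0))).
have -> : \pi_SQ (0 : FA) = 0 :> SQ by rewrite !piE.
apply: eq_bigr => m _; rewrite -SQ_pi_word -[RHS]SQ_piZ; congr (\pi_SQ _).
apply/malgP => n; rewrite [RHS]monalg.mcoeffZ !monalg.mcoeffU.
by rewrite mulrnAr mulr1.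
Qed.

Lemma SQ_hom_ext (A : algType K) (phi psi : {lrmorphism SQ -> A}) :
  (forall i, phi (v i) = psi (v i)) -> phi =1 psi.
Proof.
move=> eqv; elim/SQ_ind=> y; rewrite SQ_pi_sum !linear_sum.
apply: eq_bigr => m _; rewrite !linearZ_LR /= !rmorph_prod; congr (_ *: _).
by apply: eq_bigr => i _; apply: eqv.
Qed.

Section Homogeneous.
Local Notation homogeneous := (@homogeneous K q12 q23 q31).

Lemma homogeneous0 n : homogeneous n 0.
Proof. by exists (fun=> 0); rewrite big1 // => t _; rewrite scale0r. Qed.

Lemma homogeneousD n x y : homogeneous n x -> homogeneous n y ->
  homogeneous n (x + y).
Proof.
move=> [c ->] [d ->]; exists (fun t => c t + d t); rewrite -big_split.
by apply: eq_bigr => t _; rewrite scalerDl.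
Qed.

Lemma homogeneousZ n a x : homogeneous n x -> homogeneous n (a *: x).
Proof.
move=> [c ->]; exists (fun t => a * c t); rewrite scaler_sumr.
by apply: eq_bigr => t _; rewrite scalerA.
Qed.

Lemma homogeneous_sum n (T : Type) (r : seq T) (F : T -> SQ) :
  (forall t, homogeneous n (F t)) -> homogeneous n (\sum_(t <- r) F t).
Proof.
move=> hF; elim/big_ind: _ => //; [exact: homogeneous0 | exact: homogeneousD].
Qed.

Lemma homogeneous_word n (t : n.-tuple 'I_3) :
  homogeneous n (\prod_(i <- t) v i).
Proof.
exists (fun u => (u == t)%:R); rewrite (bigD1 t) //= eqxx scale1r.
rewrite [X in _ + X]big1 ?addr0 //.
by move=> u /negPf->; rewrite scale0r.
Qed.

Lemma homogeneous_mulv n i x : homogeneous n x -> homogeneous n.+1 (v i * x).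
Proof.
move=> [c ->]; rewrite mulr_sumr; apply: homogeneous_sum => t.
rewrite -scalerAr; apply: homogeneousZ.
by have := homogeneous_word [tuple of i :: t]; rewrite big_cons.
Qed.

(** A word of length n goes to a product of n linear forms, hence any homomorphism given by a matrix
    on the generators respects degrees. *)
Lemma homogeneous_prod_linear (M : 'M[K]_3) (s : seq 'I_3) :
  homogeneous (size s) (\prod_(j <- s) \sum_i M i j *: v i).
Proof.
elim: s => [|j s IHs] /=.
  by have := homogeneous_word [tuple]; rewrite !big_nil.
rewrite big_cons mulr_suml; apply: homogeneous_sum => i.
by rewrite -scalerAl; apply/homogeneousZ/homogeneous_mulv.
Qed.

End Homogeneous.

End SQTheory.

(** * Quadratic relations and automorphisms *)

Section Relations.
Variables (K : fieldType) (q12 q23 q31 : K).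
Hypotheses (q12_neq0 : q12 != 0) (q23_neq0 : q23 != 0) (q31_neq0 : q31 != 0).

Local Notation SQ := (SQ q12 q23 q31).
Local Notation v := (SQ_v q12 q23 q31).

(** The parameters follow the cycle 1, 2, 3, 1, so [q31] stands at (3, 1) and its inverse at (1, 3).
    With equal parameters the array is then invariant under cyclic shifts. *)
Definition qpar (i j : 'I_3) : K := mx3 1      q12    q31^-1
                                        q12^-1 1      q23
                                        q31    q23^-1 1      i j.

Lemma qparV i j : qpar i j * qpar j i = 1.
Proof.
by elim/ord3_ind: i; elim/ord3_ind: j; rewrite /qpar !mxE /= ?mulr1 ?mulfV ?mulVf.
Qed.

Lemma qpar_diag i : qpar i i = 1.
Proof. by elim/ord3_ind: i; rewrite /qpar mxE. Qed.

Definition qcommuting (A : algType K) (x : 'I_3 -> A) : Prop :=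
  forall i j, x j * x i = qpar i j *: (x i * x j).

Lemma qcommutingP (A : algType K) (x : 'I_3 -> A) :
  qcommuting x <-> [/\ x i2 * x i1 = q12 *: (x i1 * x i2),
    x i1 * x i3 = q31 *: (x i3 * x i1) & x i3 * x i2 = q23 *: (x i2 * x i3)].
Proof.
split=> [h|[h1 h2 h3]]; first by split; rewrite h /qpar mxE.
elim/ord3_ind; elim/ord3_ind; rewrite /qpar mxE /= ?scale1r //;
  by rewrite ?h1 ?h2 ?h3 scalerA mulVf ?scale1r.
Qed.

Lemma SQ_qcommuting : qcommuting v.
Proof. exact/qcommutingP/SQ_rels. Qed.

(** Off the diagonal this is the coefficient of v_i v_j after v_j v_i is rewritten. The uniform
    formula would give [X i i] twice on the diagonal, which says nothing in characteristic 2. *)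
Definition relation_defect (X : 'M[K]_3) : 'M[K]_3 :=
  \matrix_(i, j) if i == j then X i i else X i j + qpar i j * X j i.

Lemma relation_defect_linear : linear relation_defect.
Proof.
move=> c X Y; apply/matrixP=> i j; rewrite !mxE; case: eqP => // _.
by rewrite mulrDr mulrDr [c * (_ * _)]mulrCA addrACA.
Qed.

HB.instance Definition _ := GRing.isLinear.Build K 'M[K]_3 'M[K]_3 *:%R
  relation_defect relation_defect_linear.

(* The quadratic forms X with \sum_(i, j) X i j v_i v_j = 0 in S_Q(V). *)
Definition relation_space : {vspace 'M[K]_3} := lker (linfun relation_defect).

Lemma relation_spaceP (X : 'M[K]_3) : reflect
  ((forall i, X i i = 0) /\ (forall i j, i != j -> X i j = - (qpar i j * X j i)))
  (X \in relation_space).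
Proof.
rewrite memv_ker lfunE; apply: (iffP eqP) => [/matrixP h|[h0 h]].
  split=> [i|i j /negPf ne]; first by have := h i i; rewrite !mxE eqxx.
  by apply/eqP; rewrite -addr_eq0; have := h i j; rewrite !mxE ne => ->.
apply/matrixP => i j; rewrite !mxE; have [//|ne] := eqVneq i j.
by rewrite h // addNr.
Qed.

Definition relator (i j : 'I_3) : 'M[K]_3 :=
  delta_mx j i - qpar i j *: delta_mx i j.

Lemma relator_in i j : relator i j \in relation_space.
Proof.
have [->|ne] := eqVneq i j.
  by rewrite /relator qpar_diag scale1r subrr mem0v.
apply/relation_spaceP; split=> [a|a b _]; rewrite !mxE.
  rewrite [(a == j) && _]andbC; have [->|] := eqVneq a i.
    by rewrite (negPf ne) mulr0 subrr.
  by rewrite mulr0 subrr.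
rewrite [(b == j) && _]andbC [(b == i) && _]andbC.
have [/andP[/eqP-> /eqP->]|] := boolP ((a == i) && (b == j)).
  by rewrite (negPf ne) /= mulr0 subr0 sub0r.
have [/andP[/eqP-> /eqP->]|_ _] := boolP ((a == j) && (b == i)).
  by rewrite sub0r mulrN opprK mulr1 mulr0 subr0 qparV.
by rewrite mulr0 subr0 mulr0 oppr0.
Qed.

Definition quadratic_value (A : algType K) (x : 'I_3 -> A) (X : 'M[K]_3) : A :=
  \sum_i \sum_j X i j *: (x i * x j).

Lemma relation_quadratic_value (A : algType K) (x : 'I_3 -> A) X :
  qcommuting x -> X \in relation_space -> quadratic_value x X = 0.
Proof.
move=> xC /relation_spaceP[X0 XN].
apply: sum_alternating => [i|i j ne]; first by rewrite X0 scale0r.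
by rewrite (XN i j) // (xC i j) scalerA [X j i * _]mulrC scaleNr opprK.
Qed.

(** The source of the action X |-> M X M^T: a linear substitution changes the coefficient matrix of
    a quadratic expression by congruence. *)
Lemma quadratic_value_linear_comb (A : algType K) (x : 'I_3 -> A) (M X : 'M[K]_3) :
  quadratic_value (fun j => \sum_i M i j *: x i) X =
  quadratic_value x (M *m X *m M^T).
Proof.
rewrite /quadratic_value.
under eq_bigr => i _ do under eq_bigr => j _ do
  rewrite mulr_suml scaler_sumr.
under eq_bigr => i _ do under eq_bigr => j _ do under eq_bigr => a _ do
  rewrite mulr_sumr scaler_sumr.
under [RHS]eq_bigr => a _ do under eq_bigr => b _ do
  rewrite mxE scaler_suml.
under [RHS]eq_bigr => a _ do under eq_bigr => b _ do
  under eq_bigr => j _ do rewrite !mxE mulr_suml scaler_suml.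
under eq_bigr => i _ do rewrite exchange_big.
rewrite exchange_big; apply: eq_bigr => a _ /=.
under eq_bigr => i _ do rewrite exchange_big.
rewrite exchange_big; apply: eq_bigr => b _ /=.
rewrite exchange_big; apply: eq_bigr => j _ /=; apply: eq_bigr => i _.
rewrite -scalerAr -scalerAl !scalerA; congr (_ *: _).
by rewrite mulrC mulrA.
Qed.

Lemma quadratic_value_relator (A : algType K) (x : 'I_3 -> A) i j :
  quadratic_value x (relator i j) = x j * x i - qpar i j *: (x i * x j).
Proof.
have delta a b : \sum_c \sum_d (delta_mx a b : 'M[K]_3) c d *: (x c * x d) = x a * x b.
  rewrite (bigD1 a) //= (bigD1 b) //= mxE !eqxx scale1r.
  rewrite [X in _ + X + _]big1 => [|d /negPf ne]; last first.
    by rewrite mxE ne andbF scale0r.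
  rewrite [X in _ + X]big1 ?addr0 // => c /negPf ne; rewrite big1 // => d _.
  by rewrite mxE ne scale0r.
rewrite -!delta scaler_sumr -sumrB /quadratic_value; apply: eq_bigr => a _.
rewrite scaler_sumr -sumrB; apply: eq_bigr => b _.
by rewrite scalerA -scalerBl; congr (_ *: _); rewrite !mxE.
Qed.

Section QuadraticIndependence.

Let E (i j : nat) : 'M[K]_4 := delta_mx (inord i) (inord j).

Let EM i j k l : (i < 4)%N -> (j < 4)%N -> (k < 4)%N -> (l < 4)%N ->
  E i j * E k l = if j == k then E i l else 0.
Proof.
move=> *; rewrite /E -[_ * _]/(_ *m _) mul_delta_mx_cond.
by rewrite -val_eqE /= !inordK //; case: eqP; rewrite ?mulr1n.
Qed.

(* A representation on 4 x 4 matrices in which every product of two generators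
   vanishes, except that x_i x_j is a matrix unit and x_j x_i its multiple by
   qpar i j. *)
Let rep_pair (i j c : 'I_3) : 'M[K]_4 :=
  if c == i then E 0 1 + qpar i j *: E 2 3 else
  if c == j then E 1 3 + E 0 2 else 0.

(** In [rep_pair] all squares vanish, so the coefficient of v_i^2 needs its own representation: here
    the square of x_i is [E 0 3] and the other generators act as 0. *)
Let rep_square (i c : 'I_3) : 'M[K]_4 := if c == i then E 0 1 + E 1 3 else 0.

Let E03_neq0 : E 0 3 != 0.
Proof.
apply/eqP => /matrixP/(_ (inord 0) (inord 3))/eqP.
by rewrite !mxE !eqxx oner_eq0.
Qed.

Let rep_pairM i j a b : i != j -> rep_pair i j a * rep_pair i j b =
  (((a == i) && (b == j))%:R + ((a == j) && (b == i))%:R * qpar i j) *: E 0 3.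
Proof.
move=> /negPf ne; rewrite /rep_pair.
have [->|_] := eqVneq a i; have [->|_] := eqVneq b i; rewrite ?eqxx ?ne /=.
- rewrite mul0r addr0 scale0r !(mulrDl, mulrDr) -!scalerAl -!scalerAr !EM //=.
  by rewrite !(scaler0, addr0).
- rewrite mul0r addr0; case: eqP => _; rewrite ?mulr0 ?mul0r ?addr0 ?scale0r //.
  rewrite !(mulrDl, mulrDr) -!scalerAl !EM //=.
  by rewrite !(scaler0, addr0, scale1r).
- case: eqP => _; rewrite ?mul0r ?addr0 ?scale0r // add0r mul1r.
  rewrite !(mulrDl, mulrDr) -!scalerAr !EM //=.
  by rewrite !(scaler0, addr0, add0r).
case: eqP => _; rewrite ?mul0r ?andbF ?addr0 ?scale0r //=.
case: eqP => _; rewrite ?mulr0 ?mul0r ?addr0 ?scale0r //=.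
by rewrite !(mulrDl, mulrDr) !EM //= !addr0.
Qed.

Let rep_squareM i a b : rep_square i a * rep_square i b =
  ((a == i) && (b == i))%:R *: E 0 3.
Proof.
rewrite /rep_square; case: eqP => _; rewrite ?mul0r ?scale0r //.
case: eqP => _; rewrite ?mulr0 ?scale0r //.
by rewrite !(mulrDl, mulrDr) !EM //= !(addr0, add0r) scale1r.
Qed.

(** A vanishing quadratic expression vanishes in every representation: [rep_square] isolates
    [X i i], and [rep_pair] isolates [X i j + qpar i j * X j i]. *)
Lemma SQ_quadratic_independent X :
  quadratic_value v X = 0 -> X \in relation_space.
Proof.
move=> vX.
have repX (x : 'I_3 -> 'M[K]_4) : qcommuting x -> quadratic_value x X = 0.
  move=> /qcommutingP/SQ_universal[phi phiv].
  rewrite -[RHS](linear0 phi) -vX /quadratic_value linear_sum.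
  apply: eq_bigr => i _; rewrite linear_sum; apply: eq_bigr => j _.
  by rewrite linearZ_LR /= rmorphM -!phiv.
have sum_delta (i j : 'I_3) : \sum_a \sum_b X a b * ((a == i) && (b == j))%:R = X i j.
  rewrite (bigD1 i) //= (bigD1 j) //= !eqxx mulr1.
  rewrite big1 => [|b /negPf->]; last by rewrite mulr0.
  rewrite big1 ?addr0 // => a /negPf ne; rewrite big1 // => b _.
  by rewrite ne mulr0.
apply/relation_spaceP; split=> [i|i j ne].
  have := repX (rep_square i); rewrite /quadratic_value => /(_ _)/eqP.
  under eq_bigr => a _ do under eq_bigr => b _ do
    rewrite rep_squareM scalerA.
  under eq_bigr => a _ do rewrite -scaler_suml.
  rewrite -scaler_suml sum_delta scaler_eq0 (negPf E03_neq0) orbF => h.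
  apply/eqP/h => a b; rewrite !rep_squareM scalerA andbC.
  have [->|] := eqVneq a i; last by rewrite ?andbF /= mulr0.
  by have [->|] := eqVneq b i; rewrite /= ?qpar_diag ?mulr1 ?mulr0.
have := repX (rep_pair i j); rewrite /quadratic_value => /(_ _)/eqP.
under eq_bigr => a _ do under eq_bigr => b _ do
  rewrite rep_pairM // scalerA mulrDr mulrA.
under eq_bigr => a _ do rewrite -scaler_suml big_split -mulr_suml.
rewrite -scaler_suml big_split -mulr_suml !sum_delta /=.
rewrite scaler_eq0 (negPf E03_neq0) orbF addr_eq0 mulrC => h.
apply/eqP/h => a b; rewrite !rep_pairM // scalerA; congr (_ *: _).
rewrite [(b == i) && _]andbC [(b == j) && _]andbC.
have [/andP[/eqP-> /eqP->]|] := boolP ((a == i) && (b == j)).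
  by rewrite (negPf ne) /= mul0r add0r addr0 mulr1 mul1r.
have [/andP[/eqP-> /eqP->]|_ _] := boolP ((a == j) && (b == i)).
  by rewrite mul0r addr0 add0r mul1r qparV.
by rewrite mul0r addr0 mulr0.
Qed.

End QuadraticIndependence.

End Relations.

(** * Automorphisms as invertible matrices compatible with the array of parameters *)

Section Automorphisms.
Variables (K : fieldType) (q12 q23 q31 : K).
Hypotheses (q12_neq0 : q12 != 0) (q23_neq0 : q23 != 0) (q31_neq0 : q31 != 0).

Local Notation SQ := (SQ q12 q23 q31).
Local Notation v := (SQ_v q12 q23 q31).
Local Notation qpar := (qpar q12 q23 q31).
Local Notation relation_space := (relation_space q12 q23 q31).
Local Notation relator := (relator q12 q23 q31).
Local Notation qparV := (qparV q12_neq0 q23_neq0 q31_neq0).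

Definition preserves_relations (M : 'M[K]_3) : Prop :=
  forall X, X \in relation_space -> M *m X *m M^T \in relation_space.

Lemma preserves_relationsM M N : preserves_relations M -> preserves_relations N ->
  preserves_relations (M *m N).
Proof.
move=> hM hN X hX; have -> : M *m N *m X *m (M *m N)^T =
    M *m (N *m X *m N^T) *m M^T by rewrite trmx_mul !mulmxA.
exact/hM/hN.
Qed.

(** Congruence by an invertible [M] is injective, so it maps the finite-dimensional relation space
    onto itself and not merely into itself. *)
Lemma preserves_relationsV M : M \in unitmx -> preserves_relations M ->
  preserves_relations (invmx M).
Proof.
move=> uM hM X hX.
pose f : 'End('M[K]_3) := linfun (mulmxr M^T \o mulmx M).
have fE Y : f Y = M *m Y *m M^T by rewrite lfunE.
have kerf : lker f == 0%VS.
  apply/lker0P => Y Z; rewrite !fE => /(can_inj (mulmxK _)) h.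
  by apply: (can_inj (mulKmx uM)); apply: h; rewrite unitmx_tr.
have : (f @: relation_space <= relation_space)%VS.
  by apply/subvP => _ /memv_imgP[Y hY ->]; rewrite fE; apply: hM.
move=> sub; have : (f @: relation_space)%VS == relation_space.
  by rewrite eqEdim sub limg_dim_eq ?leqnn // (eqP kerf) capv0.
move/eqP => eqR; rewrite -eqR in hX; have /memv_imgP[Y hY ->] := hX.
by rewrite fE trmx_inv !mulmxA mulVmx // mul1mx mulmxK // unitmx_tr.
Qed.

Lemma preserves_relations_hom M : preserves_relations M ->
  exists phi : {lrmorphism SQ -> SQ}, forall j, phi (v j) = \sum_i M i j *: v i.
Proof.
move=> hM; pose w j := \sum_i M i j *: v i.
apply: (@SQ_universal _ _ _ _ _ w); apply/(qcommutingP q12_neq0 q23_neq0 q31_neq0).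
move=> i j.
have := relation_quadratic_value (SQ_qcommuting q12_neq0 q23_neq0 q31_neq0)
  (hM _ (relator_in q12_neq0 q23_neq0 q31_neq0 i j)).
rewrite -quadratic_value_linear_comb -/w quadratic_value_relator => /eqP.
by rewrite subr_eq0 => /eqP.
Qed.

Lemma AutSQ_preserves M :
  AutSQ q12 q23 q31 M <-> M \in unitmx /\ preserves_relations M.
Proof.
split=> [[phi [/bij_inj phi_inj _] phiv]|[uM hM]].
  split=> [|X hX].
    rewrite -unitmx_tr unitmxE unitfE; apply/det0P => -[u u0 uM].
    case/eqP: u0; apply/rowP => a; rewrite mxE.
    have sum0 : \sum_j u 0 j *: v j = 0.
      apply: phi_inj; rewrite linear0 linear_sum /=.
      under eq_bigr => j _ do rewrite linearZ_LR /= phiv scaler_sumr.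
      rewrite exchange_big big1 //= => i _.
      under eq_bigr => j _ do rewrite scalerA.
      rewrite -scaler_suml (_ : \sum_j _ = 0) ?scale0r //.
      have /rowP/(_ i) := uM; rewrite !mxE => uMi; rewrite -[RHS]uMi.
      by apply: eq_bigr => j _; rewrite mxE.
    (* Multiplying the linear relation by v_a makes it quadratic, with v_a^2 having coefficient
       [u 0 a]; independence in degree two forces this to be 0. *)
    have : (\matrix_(i, j) (u 0 i * (j == a)%:R)) \in relation_space.
      apply: SQ_quadratic_independent => //; rewrite -(mul0r (v a)) -sum0 mulr_suml.
      apply: eq_bigr => i _; rewrite (bigD1 a) //= mxE eqxx mulr1 -scalerAl.
      rewrite [X in _ + X]big1 ?addr0 // => j /negPf ne.
      by rewrite mxE ne mulr0 scale0r.
    by case/relation_spaceP => // /(_ a); rewrite mxE eqxx mulr1.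
  apply: SQ_quadratic_independent => //; rewrite -quadratic_value_linear_comb.
  have := relation_quadratic_value (SQ_qcommuting q12_neq0 q23_neq0 q31_neq0) hX.
  move/(congr1 phi); rewrite linear0 => phi0; rewrite -[RHS]phi0.
  rewrite /quadratic_value [RHS]linear_sum.
  apply: eq_bigr => i _; rewrite [RHS]linear_sum; apply: eq_bigr => j _.
  by rewrite [RHS]linearZ_LR /= rmorphM /= !phiv.
have [phi phiv] := preserves_relations_hom hM.
have [psi psiv] := preserves_relations_hom (preserves_relationsV uM hM).
have comp_id (f g : {lrmorphism SQ -> SQ}) (A B : 'M[K]_3) :
    (forall j, f (v j) = \sum_i A i j *: v i) ->
    (forall j, g (v j) = \sum_i B i j *: v i) ->
    A *m B = 1%:M -> cancel g f.
  move=> fv gv AB; apply: (@SQ_hom_ext _ _ _ _ _ (f \o g) idfun) => j /=.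
  rewrite gv linear_sum /=.
  under eq_bigr => i _ do rewrite linearZ_LR /= fv scaler_sumr.
  rewrite exchange_big /= (bigD1 j) //= [X in _ + X]big1.
    rewrite addr0; under eq_bigr => i _ do rewrite scalerA mulrC.
    rewrite -scaler_suml; have /matrixP/(_ j j) := AB.
    by rewrite !mxE eqxx => ->; rewrite scale1r.
  move=> i /negPf ne; under eq_bigr => a _ do rewrite scalerA mulrC.
  rewrite -scaler_suml; have /matrixP/(_ i j) := AB.
  by rewrite !mxE ne => ->; rewrite scale0r.
exists phi; last exact: phiv.
split.
  exists psi; first exact: (comp_id psi phi _ _ psiv phiv (mulVmx uM)).
  exact: (comp_id phi psi _ _ phiv psiv (mulmxV uM)).
move=> n _ [c ->]; rewrite linear_sum; apply: homogeneous_sum => t.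
rewrite linearZ_LR /= rmorph_prod /=; apply: homogeneousZ.
under eq_bigr => i _ do rewrite phiv.
by rewrite -[n in homogeneous n _](size_tuple t); apply: homogeneous_prod_linear.
Qed.

Definition compatible (M : 'M[K]_3) : Prop :=
  forall a i b j, M a i != 0 -> M b j != 0 -> qpar a b = qpar i j.

Lemma compatible_preserves M : compatible M -> preserves_relations M.
Proof.
move=> hM X /relation_spaceP[] // X0 XN.
have entry a b : (M *m X *m M^T) a b = \sum_i \sum_j M a i * X i j * M b j.
  rewrite mxE exchange_big; apply: eq_bigr => j _.
  by rewrite !mxE mulr_suml.
(* If an entry of [M] vanishes, both sides are 0; otherwise compatibility replaces [qpar i j] by
   [qpar a b]. *)
have swap a b i j : i != j -> M a i * X i j * M b j =
    - (qpar a b * (M b j * X j i * M a i)).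
  move=> ne; rewrite XN //.
  have [->|ai] := eqVneq (M a i) 0; first by rewrite !(mul0r, mulr0) oppr0.
  have [->|bj] := eqVneq (M b j) 0; first by rewrite !(mul0r, mulr0) oppr0.
  by rewrite (hM a i b j) //; ring.
apply/relation_spaceP => //; split=> [a|a b ne]; rewrite !entry.
  apply: sum_alternating => [i|i j ne]; first by rewrite X0 mulr0 mul0r.
  by rewrite swap 1?eq_sym // qpar_diag mul1r.
rewrite mulr_sumr -sumrN exchange_big /=; apply: eq_bigr => j _.
rewrite mulr_sumr -sumrN; apply: eq_bigr => i _.
have [->|] := eqVneq i j; last exact: swap.
by rewrite X0 !(mulr0, mul0r) oppr0.
Qed.

(* For rows: M a i and M a j both nonzero forces qpar i j = 1.  If M a i and
   M b i are nonzero but qpar a b != 1, then every 2 x 2 minor on the rows a, b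
   and column i vanishes, so these rows are proportional. *)
Lemma preserves_compatible M :
  M \in unitmx -> preserves_relations M -> compatible M.
Proof.
move=> uM hM.
have entry i j a b : (M *m relator i j *m M^T) a b =
    M a j * M b i - qpar i j * (M a i * M b j).
  have dE c d : (M *m delta_mx c d *m M^T) a b = M a c * M b d.
    rewrite mxE (bigD1 d) //= mxE (bigD1 c) //= !mxE !eqxx mulr1.
    rewrite [X in (_ + X) * _]big1 => [|e /negPf ne]; last by rewrite mxE ne mulr0.
    rewrite addr0 big1 ?addr0 // => e /negPf ne.
    by rewrite mxE big1 ?mul0r // => f _; rewrite mxE ne andbF mulr0.
  rewrite mulmxBr mulmxBl -scalemxAr -scalemxAl -!dE.
  by rewrite [LHS]mxE; congr (_ + _); rewrite [LHS]mxE; congr (- _); rewrite [LHS]mxE.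
have inR i j := hM _ (relator_in q12_neq0 q23_neq0 q31_neq0 i j).
(* The diagonal entry at [a] of the transformed relator is M_ai M_aj (1 - p_ij). *)
have row_rel a i j : M a i != 0 -> M a j != 0 -> qpar i j = 1.
  move=> ai aj; have /relation_spaceP[] := inR i j => // /(_ a) + _.
  rewrite entry [M a j * _]mulrC -{1}[M a i * _]mul1r -mulrBl => /eqP.
  by rewrite !mulf_eq0 (negPf ai) (negPf aj) !orbF subr_eq0 => /eqP.
have minor a b i j : a != b -> M a j * M b i * (1 - qpar i j * qpar a b) =
    (qpar i j - qpar a b) * (M a i * M b j).
  move=> ne; have /relation_spaceP[] := inR i j => // _ /(_ a b ne).
  rewrite !entry => /eqP; rewrite -subr_eq0 => /eqP h.
  apply/eqP; rewrite -subr_eq0 -[X in _ == X]h; apply/eqP.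
  ring.
have col_rel a b i : M a i != 0 -> M b i != 0 -> qpar a b = 1.
  move=> ai bi; have [->|neab] := eqVneq a b; first exact: qpar_diag.
  apply/eqP; apply/negPn/negP => ab1.
  (* If [qpar i j] is 1, the nonzero factor 1 - p_ab cancels from [minor]; otherwise [row_rel] makes
     both [M a j] and [M b j] zero. *)
  have prop j : M a j * M b i = M a i * M b j.
    have [ij|ij] := eqVneq (qpar i j) 1.
      have /eqP := minor a b i j neab; rewrite ij mul1r [X in X == _]mulrC -subr_eq0.
      by rewrite -mulrBr mulf_eq0 !subr_eq0 [1 == _]eq_sym (negPf ab1) => /eqP.
    have [-> |aj] := eqVneq (M a j) 0; last by rewrite (row_rel a i j) ?eqxx in ij.
    have [-> |bj] := eqVneq (M b j) 0; last by rewrite (row_rel b i j) ?eqxx in ij.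
    by rewrite mul0r mulr0.
  have : (M b i *: delta_mx 0 a - M a i *: delta_mx 0 b : 'rV_3) *m M = 0.
    rewrite mulmxBl -!scalemxAl -!rowE; apply/rowP => j.
    by rewrite !mxE [M b i * _]mulrC prop subrr.
  move/(canRL (mulmxK uM)); rewrite mul0mx => /rowP/(_ a)/eqP.
  by rewrite !mxE !eqxx (negPf neab) mulr1 mulr0 subr0 (negPf bi).
move=> a i b j ai bj.
have [eab|neab] := eqVneq a b.
  by subst b; rewrite qpar_diag (row_rel a).
have /eqP := minor a b i j neab.
(* When a crossed entry is 0, [minor] gives the equality directly; when both are nonzero, [row_rel]
   and [col_rel] make both parameters 1. *)
have [aj|aj] := eqVneq (M a j) 0.
  by rewrite aj !mul0r eq_sym !mulf_eq0 (negPf ai) (negPf bj) !orbF subr_eq0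
    => /eqP.
have [bi|bi] := eqVneq (M b i) 0.
  by rewrite bi mulr0 mul0r eq_sym !mulf_eq0 (negPf ai) (negPf bj) !orbF subr_eq0
    => /eqP.
by rewrite (row_rel a i j) // (col_rel a b i).
Qed.

Lemma AutSQP M :
  AutSQ q12 q23 q31 M <-> M \in unitmx /\ compatible M.
Proof.
split=> [/AutSQ_preserves[uM hM]|[uM hM]].
  by split=> //; apply: preserves_compatible.
by apply/AutSQ_preserves; split=> //; apply: compatible_preserves.
Qed.

End Automorphisms.

(** * Classification *)

Lemma ord3_injP (s : 'I_3 -> 'I_3) : injective s ->
  (s i1 = i1 /\ s i2 = i2 /\ s i3 = i3) \/ (s i1 = i2 /\ s i2 = i3 /\ s i3 = i1) \/
  (s i1 = i3 /\ s i2 = i1 /\ s i3 = i2) \/ (s i1 = i2 /\ s i2 = i1 /\ s i3 = i3) \/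
  (s i1 = i3 /\ s i2 = i2 /\ s i3 = i1) \/ (s i1 = i1 /\ s i2 = i3 /\ s i3 = i2).
Proof.
move=> inj_s.
have n12 : s i1 != s i2 by rewrite (inj_eq inj_s).
have n13 : s i1 != s i3 by rewrite (inj_eq inj_s).
have n23 : s i2 != s i3 by rewrite (inj_eq inj_s).
move: (s i1) (s i2) (s i3) n12 n13 n23.
by elim/ord3_ind; elim/ord3_ind; elim/ord3_ind => //; tauto.
Qed.

(** Some term of the Leibniz expansion of the determinant is nonzero. *)
Lemma unitmx_transversal (K : fieldType) n (M : 'M[K]_n) : M \in unitmx ->
  exists2 s : 'I_n -> 'I_n, injective s & forall j, M (s j) j != 0.
Proof.
rewrite -unitmx_tr unitmxE unitfE => detM.
have [/existsP[s /forallP hs]|/existsPn h] :=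
  boolP [exists s : 'S_n, [forall j, M (s j) j != 0]].
  by exists s => //; apply: perm_inj.
case/eqP: detM; rewrite /determinant big1 // => s _.
have /forallPn[j] := h s; rewrite negbK => /eqP Mj.
by rewrite (bigD1 j) //= mxE Mj mul0r mulr0.
Qed.

Lemma mx3_ext (K : fieldType) (M : 'M[K]_3) :
  M = mx3 (M i1 i1) (M i1 i2) (M i1 i3) (M i2 i1) (M i2 i2) (M i2 i3)
          (M i3 i1) (M i3 i2) (M i3 i3).
Proof. by apply/matrixP; elim/ord3_ind; elim/ord3_ind; rewrite !mxE. Qed.

Section Classification.
Variables (K : fieldType) (q12 q23 q31 : K).
Hypotheses (q12_neq0 : q12 != 0) (q23_neq0 : q23 != 0) (q31_neq0 : q31 != 0).

Local Notation qpar := (qpar q12 q23 q31).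
Local Notation compatible := (compatible q12 q23 q31).
Local Notation Aut := (AutSQ q12 q23 q31).

Lemma qparE : ((qpar i1 i2 = q12) * (qpar i2 i1 = q12^-1) * (qpar i2 i3 = q23) *
  (qpar i3 i2 = q23^-1) * (qpar i3 i1 = q31) * (qpar i1 i3 = q31^-1) *
  (qpar i1 i1 = 1) * (qpar i2 i2 = 1) * (qpar i3 i3 = 1))%type.
Proof. by rewrite /qpar !mxE. Qed.

(** Preservation of relations passes to products and inverses, so only generators need to be checked
    for compatibility. *)
Lemma AutSQ_generated (X : set 'M[K]_3) :
  (X `<=` Aut)%classic -> (generated X `<=` Aut)%classic.
Proof.
have AutP := AutSQ_preserves q12_neq0 q23_neq0 q31_neq0.
move=> sub M; elim=> {M} [M /sub //||M N _ /AutP[uM hM] _ /AutP[uN hN]|M _ /AutP[uM hM]].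
- apply/AutP; split; first exact: unitmx1.
  by move=> X' hX; rewrite trmx1 mul1mx mulmx1.
- apply/AutP; split; first by rewrite unitmx_mul uM uN.
  exact: preserves_relationsM.
- apply/AutP; split; first by rewrite unitmx_inv.
  exact: preserves_relationsV.
Qed.

Lemma torus_Aut M : torus K M -> Aut M.
Proof.
move=> [/is_diag_mxP dM uM]; apply/(AutSQP q12_neq0 q23_neq0 q31_neq0).
split=> // a i b j ai bj.
have eqd c d : M c d != 0 -> c = d.
  by move=> Mcd; apply/eqP/negPn/negP => ne; case/eqP: Mcd; apply: dM.
by rewrite (eqd a i) // (eqd b j).
Qed.

Section Transversal.
Variables (M : 'M[K]_3) (s : 'I_3 -> 'I_3).
Hypotheses (cM : compatible M) (inj_s : injective s) (Ms : forall j, M (s j) j != 0).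

Lemma transversal_qpar i j : qpar (s i) (s j) = qpar i j.
Proof. exact: cM. Qed.

Lemma transversal_twin a j : M a j != 0 -> forall b, qpar a b = qpar (s j) b.
Proof.
move=> Maj b; have [t _ ts] := injF_bij inj_s.
by rewrite -[b]ts transversal_qpar; apply: cM.
Qed.

Lemma transversal_monomial : (forall i j, i != j -> qpar i j != 1) ->
  forall a j, M a j != 0 -> a = s j.
Proof.
move=> q1 a j /transversal_twin/(_ (s j)); rewrite qpar_diag => /eqP h.
by apply/eqP; apply: contraLR h => /q1.
Qed.

(** The index [t] is singled out: [p] and [r] relate symmetrically to each other and alike to [t],
    but differently in the two situations. So [s] fixes [t], and [t] has no twin. *)
Lemma transversal_block p r t : p != r -> p != t -> r != t ->
  qpar p r = qpar r p -> qpar p t = qpar r t -> qpar p t != qpar p r ->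
  [/\ s t = t, M p t = 0, M r t = 0, M t p = 0 & M t r = 0].
Proof.
move=> pr pt rt qpr qt ne.
have cover x : x != t -> x = p \/ x = r.
  move: pr pt rt; move: p r t x {qpr qt ne}.
  by elim/ord3_ind; elim/ord3_ind => //; elim/ord3_ind => //; elim/ord3_ind => //; auto.
have q_t b : b != t -> qpar b t = qpar p t by move=> /cover[]->.
have V i j : qpar i j = 1 -> qpar j i = 1.
  by move=> h; rewrite -[LHS]mul1r -{1}h qparV.
have st : s t = t.
  apply/eqP/negPn/negP => /cover st.
  (* Take [b] with [s b] the other one of [p] and [r]; as [b] differs from [t], invariance under [s]
     would give p_pr = p_pt. *)
  have [b stb qb] : exists2 b, s b != s t & qpar (s b) (s t) = qpar p r.
    have [g _ sg] := injF_bij inj_s.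
    by case: st => ->; [exists (g r)|exists (g p)]; rewrite sg // eq_sym.
  case/eqP: ne; rewrite -qb transversal_qpar q_t //.
  by apply: contraNneq stb => ->.
(* A twin of [t] would make p_pt equal to 1, and then p_pr as well. *)
have notwin a : a != t -> ~ (forall x, qpar a x = qpar t x).
  move=> nat tw.
  have pt1 : qpar p t = 1 by rewrite -(q_t a) //; apply: V; rewrite -tw qpar_diag.
  case/eqP: ne; rewrite pt1; apply: esym.
  case: (cover a nat) => ea; rewrite ea in tw.
    by rewrite tw; apply: V; rewrite -qt.
  by rewrite qpr tw; apply: V.
have sa a : a != t -> s a != t by move=> nat; rewrite -st (inj_eq inj_s).
have zt a : a != t -> M a t = 0.
  move=> nat; apply/eqP/negPn/negP => /transversal_twin; rewrite st.
  exact: notwin.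
have tz a : a != t -> M t a = 0.
  move=> nat; apply/eqP/negPn/negP => /transversal_twin tw.
  by apply: (notwin (s a)); [exact: sa | move=> x; rewrite tw].
by split; auto.
Qed.

(* Without the coincidences excluded here, qpar has no automorphism and no two
   indices play the same role. *)
Lemma transversal_diagonal :
  ~ (q12 = q23 /\ q23 = q31) ->
  ~ (q12 ^+ 2 = 1 /\ q23 = q31^-1) -> ~ (q31 ^+ 2 = 1 /\ q12 = q23^-1) ->
  ~ (q23 ^+ 2 = 1 /\ q12 = q31^-1) -> forall a j, M a j != 0 -> a = j.
Proof.
move=> n0 n12 n31 n23.
have sq (x : K) : x != 0 -> x = x^-1 -> x ^+ 2 = 1.
  by move=> x0 e; rewrite expr2 {2}e mulfV.
have sid j : s j = j.
  have [[e1 [e2 e3]]|h] := ord3_injP inj_s; first by elim/ord3_ind: j.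
  (* A 3-cycle forces all parameters to be equal; a transposition forces one to be self-inverse and
     the other two mutually inverse. *)
  exfalso; have := transversal_qpar i1 i2; have := transversal_qpar i1 i3.
  have := transversal_qpar i2 i3.
  have [|[|[|[|]]]] := h; case=> -> [-> ->]; rewrite !qparE => e23 e13 e12.
  - by case: n0.
  - by case: n0; rewrite -e23 e12.
  - by case: n12; rewrite -e23; split=> //; apply: sq.
  - by case: n31; rewrite -e12; split=> //; apply: sq.
  - by case: n23; rewrite -e12; split=> //; apply: sq.
(* Distinct twins have parameter 1 between them and are alike towards the third index, again an
   excluded coincidence. *)
move=> a j /transversal_twin; rewrite sid.
elim/ord3_ind: a; elim/ord3_ind: j => // tw; exfalso;
  have := tw i1; have := tw i2; have := tw i3; rewrite !qparE => t3 t2 t1.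
- by apply: n12; rewrite t2 t3 expr1n.
- by apply: n31; rewrite -t1 t2 expr1n.
- by apply: n12; rewrite -t2 t3 expr1n.
- by apply: n23; rewrite t3 -t1 invrK expr1n.
- by apply: n31; rewrite t1 t2 expr1n.
- by apply: n23; rewrite -t3 t1 invrK expr1n.
Qed.

End Transversal.
End Classification.

Local Open Scope classical_set_scope.

(** * The automorphism group in each of the cases *)

Section AutomorphismGroups.
Variables (K : fieldType) (q12 q23 q31 : K).
Hypotheses (q12_neq0 : q12 != 0) (q23_neq0 : q23 != 0) (q31_neq0 : q31 != 0).

Local Notation qpar := (qpar q12 q23 q31).
Local Notation compatible := (compatible q12 q23 q31).
Local Notation Aut := (AutSQ q12 q23 q31).

Let AutP := AutSQP q12_neq0 q23_neq0 q31_neq0.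

Let qE := qparE q12 q23 q31.

Lemma AutSQ_case_i : case_i q12 q23 q31 -> Aut = GLset K.
Proof.
move=> [e1 e2 e3]; apply/seteqP; split=> M; first by case/AutP.
have q1 i j : qpar i j = 1.
  by elim/ord3_ind: i; elim/ord3_ind: j; rewrite qE ?e1 ?e2 ?e3 ?invr1.
by move=> uM; apply/AutP; split=> // a i b j _ _; rewrite !q1.
Qed.

Lemma AutSQ_case_ii : case_ii q12 q23 q31 -> Aut = GLset K `&` monomial_set K.
Proof.
move=> [N1 [e1 e2 e3]].
have q_if i j : qpar i j = if i == j then 1 else -1.
  by elim/ord3_ind: i; elim/ord3_ind: j; rewrite qE ?e1 ?e2 ?e3 ?invrN1.
apply/seteqP; split=> M.
  move=> /AutP[uM cM]; split=> //.
  have [s inj_s Ms] := unitmx_transversal uM.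
  have mono a j : M a j != 0 -> a = s j.
    apply: (transversal_monomial cM inj_s Ms) => i i' /negPf ne.
    by rewrite q_if ne.
  split=> [i|j].
    have [g gs sg] := injF_bij inj_s; exists (g i); split.
      by have := Ms (g i); rewrite sg.
    by move=> j /mono->; rewrite gs.
  by exists (s j); split=> // a /mono.
(* Two nonzero entries of a monomial matrix share a row exactly when they share a column. *)
move=> [uM [rowM colM]]; apply/AutP; split=> // a i b j ai bj; rewrite !q_if.
have [eab|neab] := eqVneq a b; have [eij|neij] := eqVneq i j => //.
  have [c [_ uc]] := rowM a; case/eqP: neij.
  by rewrite -(uc i) // -(uc j) // eab.
have [c [_ uc]] := colM i; case/eqP: neab.
by rewrite -(uc a) // -(uc b) // eij.
Qed.

Lemma diagonal_torus (M : 'M[K]_3) :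
  M \in unitmx -> (forall a j, M a j != 0 -> a = j) -> torus K M.
Proof.
move=> uM dM; split=> //; apply/is_diag_mxP => a j ne.
by apply/eqP; apply: contraNT ne => /dM->.
Qed.

(** Eliminates [c]: only the position of [e] and the inverse relation between the other two
    parameters matter. *)
Lemma multiset_eqP (e : K) :
  (exists2 c, c != 0 & multiset_eq q12 q23 q31 e c) <->
  [\/ q23 = e /\ q12 = q31^-1, q31 = e /\ q12 = q23^-1 | q12 = e /\ q23 = q31^-1].
Proof.
have two (x y z c : K) : perm_eq [:: x; y; z] [:: e; c; c^-1] -> x = e -> y = z^-1.
  move=> + xe; rewrite xe perm_cons => h.
  have := perm_mem h y; rewrite !inE eqxx => /esym/orP[] /eqP yc.
    by move: h; rewrite yc perm_cons => /perm_mem/(_ z); rewrite !inE eqxx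
      => /esym/eqP->; rewrite invrK.
  move: h; rewrite perm_sym -(perm_rcons _ [:: c^-1]) /= yc perm_sym perm_cons.
  by move=> /perm_mem/(_ z); rewrite !inE eqxx => /esym/eqP->.
split=> [[c c0 h]|].
  have := perm_mem h e; rewrite !inE eqxx /= => /or3P[] /eqP ee.
  - by constructor 3; rewrite ee; split=> //; apply: two h (esym ee).
  - constructor 1; rewrite ee; split=> //.
    by apply: (two q23 _ _ c) (esym ee); rewrite (perm_catCA [:: q23] [:: q12] [:: q31]).
  - constructor 2; rewrite ee; split=> //.
    by apply: (two q31 _ _ c) (esym ee); rewrite (perm_catC [:: q31] [:: q12; q23]).
case=> -[ee xz].
- exists q12 => //; rewrite /multiset_eq ee xz invrK.
  by rewrite (perm_catCA [:: q31^-1] [:: e] [:: q31]).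
- exists q12 => //; rewrite /multiset_eq ee xz invrK.
  by rewrite (perm_catC [:: q23^-1; q23] [:: e]).
- by exists q23 => //; rewrite /multiset_eq ee xz invrK.
Qed.

Lemma multiset_eq_const (e c : K) : multiset_eq q12 q23 q31 e c ->
  q12 = e -> q23 = e -> q31 = e -> c = e.
Proof.
move=> /perm_mem/(_ c) + e1 e2 e3.
by rewrite e1 e2 e3 !inE eqxx orbT !orbb => /eqP.
Qed.

Lemma AutSQ_case_iii : case_iii q12 q23 q31 -> Aut = torus K.
Proof.
move=> [neq nms]; apply/seteqP; split=> M; last exact: torus_Aut.
move=> /AutP[uM cM]; apply: diagonal_torus => //.
have [s inj_s Ms] := unitmx_transversal uM.
(* A square root of 1 is 1 or -1, so each coincidence excluded by [transversal_diagonal] is one of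
   the forbidden multisets. *)
have no z : z ^+ 2 = 1 -> ~ [\/ q23 = z /\ q12 = q31^-1, q31 = z /\ q12 = q23^-1
    | q12 = z /\ q23 = q31^-1].
  move=> /eqP + /multiset_eqP[c c0 h]; rewrite sqrf_eq1 => /orP[] /eqP e;
    by rewrite e in h; apply: nms; exists c => //; auto.
apply: (transversal_diagonal q12_neq0 q23_neq0 q31_neq0 cM inj_s Ms) => //;
  move=> -[/no sq e]; apply: sq.
- by constructor 3.
- by constructor 2.
- by constructor 1.
Qed.

(** Converse to [transversal_qpar] and [transversal_twin]: a symmetry of the array, up to twins, is
    enough for compatibility. *)
Lemma compatible_of (s : 'I_3 -> 'I_3) (M : 'M[K]_3) :
  (forall i j, qpar (s i) (s j) = qpar i j) ->
  (forall a j, M a j != 0 -> forall b, qpar a b = qpar (s j) b) -> compatible M.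
Proof.
move=> qs tw a i b j /tw ai /tw bj.
have V c d : qpar c d = (qpar d c)^-1.
  by rewrite -[LHS]divr1 -(qparV q12_neq0 q23_neq0 q31_neq0 c d) invfM mulrA mulfV
    ?mul1r //; elim/ord3_ind: c; elim/ord3_ind: d; rewrite qE ?invr_eq0 ?oner_eq0.
by rewrite ai V bj -V qs.
Qed.

Lemma AutSQ_case_iv : case_iv q12 q23 q31 -> Aut = generated (GLset K `&`
  ([set M | exists a12 a23 a31, M = mx3 0   a12 0
                                        0   0   a23
                                        a31 0   0] `|`
   [set M | exists a13 a21 a32, M = mx3 0   0   a13
                                        a21 0   0
                                        0   a32 0])).
Proof.
move=> [e12 e23 q1 qN1]; have e31 : q31 = q12 by rewrite e12.
rewrite -e12 in e23; apply/seteqP; split=> M; last first.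
  apply: AutSQ_generated => // {M} N [uN cyc]; apply/AutP; split=> //.
  case: cyc => -[a [b [c ->]]].
    (* [s] sends each column to the row of its nonzero entry. *)
    pose s (i : 'I_3) := if i == i1 then i3 else if i == i2 then i1 else i2.
    apply: (@compatible_of s) => [i j|i j].
      by elim/ord3_ind: i; elim/ord3_ind: j; rewrite /s /= !qE -?e12 ?e31.
    by elim/ord3_ind: i; elim/ord3_ind: j; rewrite mxE /= ?eqxx.
  pose s (i : 'I_3) := if i == i1 then i2 else if i == i2 then i3 else i1.
  apply: (@compatible_of s) => [i j|i j].
    by elim/ord3_ind: i; elim/ord3_ind: j; rewrite /s /= !qE -?e12 ?e31.
  by elim/ord3_ind: i; elim/ord3_ind: j; rewrite mxE /= ?eqxx.
move=> /AutP[uM cM]; have [s inj_s Ms] := unitmx_transversal uM.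
have mono a j : M a j != 0 -> a = s j.
  apply: (transversal_monomial cM inj_s Ms) => // i j'.
  elim/ord3_ind: i; elim/ord3_ind: j' => //; rewrite qE -?e12 ?e31 ?invr_eq1 //.
have M0 a j : a != s j -> M a j = 0.
  by move=> ne; apply/eqP; apply: contraNT ne => /mono->.
(* Rules out the transpositions, each of which would invert a parameter. *)
have sqrtN x : x = q12 -> x^-1 <> x.
  move=> -> h; have /eqP := mulfV q12_neq0; rewrite h -expr2 sqrf_eq1.
  by rewrite (negPf q1) (negPf qN1).
have tq := transversal_qpar cM Ms.
have := tq i1 i2; have := tq i1 i3; have := tq i2 i3.
have [|[|[|[|[|]]]]] := ord3_injP inj_s; case=> s1 [s2 s3];
  rewrite s1 s2 s3 !qE => t23 t13 t12.
(* A diagonal matrix is not one of the generators; it is a product of one of each shape, the second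
   factor being a permutation matrix. *)
- pose C1 := mx3 0 (M i1 i1) 0 0 0 (M i2 i2) (M i3 i3) 0 0.
  pose C2 : 'M[K]_3 := mx3 0 0 1 1 0 0 0 1 0.
  have MC : M = C1 *m C2.
    rewrite [LHS]mx3_ext; apply/matrixP; elim/ord3_ind; elim/ord3_ind;
    rewrite !mxE sum_ord3 !mxE /= ?mulr0 ?mul0r ?mulr1 ?addr0 ?add0r //;
    by rewrite M0 // ?s1 ?s2 ?s3.
  have /andP[u1 u2] : (C1 \in unitmx) && (C2 \in unitmx).
    by rewrite -unitmx_mul -MC.
  rewrite MC; apply: Gen_M; apply: Gen_in; split=> //.
    by left; do 3 eexists.
  by right; do 3 eexists.
- apply: Gen_in; split=> //; right; exists (M i1 i3), (M i2 i1), (M i3 i2).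
  apply/matrixP; elim/ord3_ind; elim/ord3_ind; rewrite mxE //=;
    by rewrite M0 // ?s1 ?s2 ?s3.
- apply: Gen_in; split=> //; left; exists (M i1 i2), (M i2 i3), (M i3 i1).
  apply/matrixP; elim/ord3_ind; elim/ord3_ind; rewrite mxE //=;
    by rewrite M0 // ?s1 ?s2 ?s3.
- by case: (sqrtN q12).
- by case: (sqrtN q31).
- by case: (sqrtN q23).
Qed.

Lemma AutSQ_block M p r t : Aut M -> p != r -> p != t -> r != t ->
  qpar p r = qpar r p -> qpar p t = qpar r t -> qpar p t != qpar p r ->
  [/\ M p t = 0, M r t = 0, M t p = 0 & M t r = 0].
Proof.
move=> /AutP[uM cM] pr pt rt h1 h2 h3.
have [s inj_s Ms] := unitmx_transversal uM.
by have [] := transversal_block q12_neq0 q23_neq0 q31_neq0 cM inj_s Ms pr pt rt h1 h2 h3.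
Qed.

(** Since p_pr is not 1, no column has nonzero entries in both rows [p] and [r]; as [s] permutes
    these two indices, the block is diagonal or antidiagonal. *)
Lemma AutSQ_block_monomial M p r t : Aut M -> p != r -> p != t -> r != t ->
  qpar p r = qpar r p -> qpar p t = qpar r t -> qpar p t != qpar p r ->
  qpar p r != 1 -> (M p r = 0 /\ M r p = 0) \/ (M p p = 0 /\ M r r = 0).
Proof.
move=> AM pr pt rt h1 h2 h3 h4.
have [z1 z2 z3 z4] := AutSQ_block AM pr pt rt h1 h2 h3; move: AM => /AutP[uM cM].
have [s inj_s Ms] := unitmx_transversal uM.
have col j a b : qpar a b != 1 -> M a j != 0 -> M b j = 0.
  move=> q1 aj; apply/eqP; apply: contraNT q1 => bj.
  by rewrite (cM a j b j) // qpar_diag.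
have q_rp : qpar r p != 1 by rewrite -h1.
have cover x : x != t -> x = p \/ x = r.
  move: pr pt rt; move: p r t x {h1 h2 h3 h4 z1 z2 z3 z4 q_rp}.
  by elim/ord3_ind; elim/ord3_ind => //; elim/ord3_ind => //; elim/ord3_ind => //; auto.
have sp : s p != t by apply: contraNneq (Ms p) => ->; rewrite z3.
have sr : s r != t by apply: contraNneq (Ms r) => ->; rewrite z4.
have spr : s p != s r by rewrite (inj_eq inj_s).
have := Ms p; have := Ms r.
case: (cover _ sp) (cover _ sr) spr => -> [] ->; rewrite ?eqxx // => _ Mr Mp.
  by left; split; [apply: col Mr | apply: col Mp].
by right; split; [apply: col Mp | apply: col Mr].
Qed.

(** Here 2 and 3 are twins and 1 is singled out, so the converse holds with [s] the identity: any
    entries in the 2 x 2 block are compatible. *)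
Lemma AutSQ_case_v_a : q23 = 1 -> q12 = q31^-1 -> q12 <> 1 -> Aut = GLset K `&`
  [set M | exists a11 a22 a23 a32 a33, M = mx3 a11 0   0
                                               0   a22 a23
                                               0   a32 a33].
Proof.
move=> e23 e12 /eqP n1; apply/seteqP; split=> M.
  move=> AM; split; first by case/AutP: (AM).
  have [|||z1 z2 z3 z4] := @AutSQ_block M i2 i3 i1 AM isT isT isT; rewrite ?qE.
  - by rewrite e23 invr1.
  - by rewrite e12 invrK.
  - by rewrite e23 invr_eq1.
  exists (M i1 i1), (M i2 i2), (M i2 i3), (M i3 i2), (M i3 i3).
  by rewrite {1}[M]mx3_ext z1 z2 z3 z4.
move=> [uM [a [b [c [d [e eM]]]]]]; apply/AutP; split=> //; rewrite {}eM {uM}.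
apply: (@compatible_of id) => // x y.
elim/ord3_ind: x; elim/ord3_ind: y; rewrite mxE /= ?eqxx // => _;
  by elim/ord3_ind; rewrite !qE ?e12 ?e23 ?invrK ?invr1.
Qed.

Lemma AutSQ_case_v_b : q31 = 1 -> q12 = q23^-1 -> q12 <> 1 -> Aut = GLset K `&`
  [set M | exists a11 a13 a22 a31 a33, M = mx3 a11 0   a13
                                               0   a22 0
                                               a31 0   a33].
Proof.
move=> e31 e12 /eqP n1; apply/seteqP; split=> M.
  move=> AM; split; first by case/AutP: (AM).
  have [|||z1 z2 z3 z4] := @AutSQ_block M i1 i3 i2 AM isT isT isT; rewrite ?qE.
  - by rewrite e31 invr1.
  - exact: e12.
  - by rewrite e31 invr1.
  exists (M i1 i1), (M i1 i3), (M i2 i2), (M i3 i1), (M i3 i3).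
  by rewrite {1}[M]mx3_ext z1 z2 z3 z4.
move=> [uM [a [b [c [d [e eM]]]]]]; apply/AutP; split=> //; rewrite {}eM {uM}.
apply: (@compatible_of id) => // x y.
elim/ord3_ind: x; elim/ord3_ind: y; rewrite mxE /= ?eqxx // => _;
  by elim/ord3_ind; rewrite !qE ?e12 ?e31 ?invrK ?invr1.
Qed.

Lemma AutSQ_case_v_c : q12 = 1 -> q23 = q31^-1 -> q23 <> 1 -> Aut = GLset K `&`
  [set M | exists a11 a12 a21 a22 a33, M = mx3 a11 a12 0
                                               a21 a22 0
                                               0   0   a33].
Proof.
move=> e12 e23 /eqP n1; apply/seteqP; split=> M.
  move=> AM; split; first by case/AutP: (AM).
  have [|||z1 z2 z3 z4] := @AutSQ_block M i1 i2 i3 AM isT isT isT; rewrite ?qE.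
  - by rewrite e12 invr1.
  - by rewrite e23.
  - by rewrite e12 -e23.
  exists (M i1 i1), (M i1 i2), (M i2 i1), (M i2 i2), (M i3 i3).
  by rewrite {1}[M]mx3_ext z1 z2 z3 z4.
move=> [uM [a [b [c [d [e eM]]]]]]; apply/AutP; split=> //; rewrite {}eM {uM}.
apply: (@compatible_of id) => // x y.
elim/ord3_ind: x; elim/ord3_ind: y; rewrite mxE /= ?eqxx // => _;
  by elim/ord3_ind; rewrite !qE ?e12 ?e23 ?invrK ?invr1.
Qed.

(** Swapping 2 and 3 is a symmetry, but they are not twins because -1 differs from 1. Each
    automorphism is already a generator, so no products are needed. *)
Lemma AutSQ_case_vi_a : (-1 : K) != 1 -> q23 = -1 -> q12 = q31^-1 -> q12 <> -1 ->
  Aut = generated (torus K `|` (GLset K `&`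
    [set M | exists a11 a23 a32, M = mx3 a11 0   0
                                         0   0   a23
                                         0   a32 0])).
Proof.
move=> N1 e23 e12 /eqP n1; apply/seteqP; split=> M; last first.
  apply: AutSQ_generated => // {M} M [/torus_Aut|[uM [a [b [c eM]]]]]; first exact.
  apply/AutP; split=> //; rewrite {}eM {uM}.
  pose s (i : 'I_3) := if i == i1 then i1 else if i == i2 then i3 else i2.
  apply: (@compatible_of s) => [i j|i j].
    by elim/ord3_ind: i; elim/ord3_ind: j; rewrite /s /= !qE ?e12 ?e23 ?invrK ?invrN1.
  by elim/ord3_ind: i; elim/ord3_ind: j; rewrite mxE /= ?eqxx.
move=> AM; apply: Gen_in; have uM : M \in unitmx by case/AutP: (AM).
have h1 : qpar i2 i3 = qpar i3 i2 by rewrite !qE e23 invrN1.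
have h2 : qpar i2 i1 = qpar i3 i1 by rewrite !qE e12 invrK.
have h3 : qpar i2 i1 != qpar i2 i3.
  by rewrite !qE e23 -invrN1 (inj_eq invr_inj).
have h4 : qpar i2 i3 != 1 by rewrite qE e23.
have [z1 z2 z3 z4] := @AutSQ_block M i2 i3 i1 AM isT isT isT h1 h2 h3.
have [[z5 z6]|[z5 z6]] := @AutSQ_block_monomial M i2 i3 i1 AM isT isT isT h1 h2 h3 h4.
  left; apply: diagonal_torus => // a j.
  by elim/ord3_ind: a; elim/ord3_ind: j; rewrite ?z1 ?z2 ?z3 ?z4 ?z5 ?z6 ?eqxx.
right; split=> //; exists (M i1 i1), (M i2 i3), (M i3 i2).
by rewrite {1}[M]mx3_ext z1 z2 z3 z4 z5 z6.
Qed.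

Lemma AutSQ_case_vi_b : (-1 : K) != 1 -> q31 = -1 -> q12 = q23^-1 -> q12 <> -1 ->
  Aut = generated (torus K `|` (GLset K `&`
    [set M | exists a13 a22 a31, M = mx3 0   0   a13
                                         0   a22 0
                                         a31 0   0])).
Proof.
move=> N1 e31 e12 /eqP n1; apply/seteqP; split=> M; last first.
  apply: AutSQ_generated => // {M} M [/torus_Aut|[uM [a [b [c eM]]]]]; first exact.
  apply/AutP; split=> //; rewrite {}eM {uM}.
  pose s (i : 'I_3) := if i == i1 then i3 else if i == i2 then i2 else i1.
  apply: (@compatible_of s) => [i j|i j].
    by elim/ord3_ind: i; elim/ord3_ind: j; rewrite /s /= !qE ?e12 ?e31 ?invrK ?invrN1.
  by elim/ord3_ind: i; elim/ord3_ind: j; rewrite mxE /= ?eqxx.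
move=> AM; apply: Gen_in; have uM : M \in unitmx by case/AutP: (AM).
have h1 : qpar i1 i3 = qpar i3 i1 by rewrite !qE e31 invrN1.
have h2 : qpar i1 i2 = qpar i3 i2 by rewrite !qE.
have h3 : qpar i1 i2 != qpar i1 i3 by rewrite !qE e31 invrN1.
have h4 : qpar i1 i3 != 1 by rewrite qE e31 invrN1.
have [z1 z2 z3 z4] := @AutSQ_block M i1 i3 i2 AM isT isT isT h1 h2 h3.
have [[z5 z6]|[z5 z6]] := @AutSQ_block_monomial M i1 i3 i2 AM isT isT isT h1 h2 h3 h4.
  left; apply: diagonal_torus => // a j.
  by elim/ord3_ind: a; elim/ord3_ind: j; rewrite ?z1 ?z2 ?z3 ?z4 ?z5 ?z6 ?eqxx.
right; split=> //; exists (M i1 i3), (M i2 i2), (M i3 i1).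
by rewrite {1}[M]mx3_ext z1 z2 z3 z4 z5 z6.
Qed.

Lemma AutSQ_case_vi_c : (-1 : K) != 1 -> q12 = -1 -> q23 = q31^-1 -> q23 <> -1 ->
  Aut = generated (torus K `|` (GLset K `&`
    [set M | exists a12 a21 a33, M = mx3 0   a12 0
                                         a21 0   0
                                         0   0   a33])).
Proof.
move=> N1 e12 e23 /eqP n1; apply/seteqP; split=> M; last first.
  apply: AutSQ_generated => // {M} M [/torus_Aut|[uM [a [b [c eM]]]]]; first exact.
  apply/AutP; split=> //; rewrite {}eM {uM}.
  pose s (i : 'I_3) := if i == i1 then i2 else if i == i2 then i1 else i3.
  apply: (@compatible_of s) => [i j|i j].
    by elim/ord3_ind: i; elim/ord3_ind: j; rewrite /s /= !qE ?e12 ?e23 ?invrK ?invrN1.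
  by elim/ord3_ind: i; elim/ord3_ind: j; rewrite mxE /= ?eqxx.
move=> AM; apply: Gen_in; have uM : M \in unitmx by case/AutP: (AM).
have h1 : qpar i1 i2 = qpar i2 i1 by rewrite !qE e12 invrN1.
have h2 : qpar i1 i3 = qpar i2 i3 by rewrite !qE e23.
have h3 : qpar i1 i3 != qpar i1 i2 by rewrite !qE e12 -e23.
have h4 : qpar i1 i2 != 1 by rewrite qE e12.
have [z1 z2 z3 z4] := @AutSQ_block M i1 i2 i3 AM isT isT isT h1 h2 h3.
have [[z5 z6]|[z5 z6]] := @AutSQ_block_monomial M i1 i2 i3 AM isT isT isT h1 h2 h3 h4.
  left; apply: diagonal_torus => // a j.
  by elim/ord3_ind: a; elim/ord3_ind: j; rewrite ?z1 ?z2 ?z3 ?z4 ?z5 ?z6 ?eqxx.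
right; split=> //; exists (M i1 i2), (M i2 i1), (M i3 i3).
by rewrite {1}[M]mx3_ext z1 z2 z3 z4 z5 z6.
Qed.

End AutomorphismGroups.

(** * The six cases are exhaustive and mutually exclusive *)

Section CaseDistinction.
Variables (K : fieldType) (q12 q23 q31 : K).
Hypotheses (q12_neq0 : q12 != 0) (q23_neq0 : q23 != 0) (q31_neq0 : q31 != 0).

Local Notation ms := (multiset_eq q12 q23 q31).

Lemma multiset_eq_mem (e c : K) : ms e c -> [\/ q12 = e, q23 = e | q31 = e].
Proof.
move=> /perm_mem/(_ e); rewrite !inE eqxx /= => /or3P[] /eqP->;
  by [constructor 1|constructor 2|constructor 3].
Qed.

(** The product of the parameters recovers [e]; this separates the multisets with 1 from those with
    -1. *)
Lemma multiset_eq_prod (e c : K) : c != 0 -> ms e c -> q12 * q23 * q31 = e.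
Proof.
move=> c0 h; have : \prod_(x <- [:: q12; q23; q31]) x = \prod_(x <- [:: e; c; c^-1]) x.
  exact: perm_big.
by rewrite !big_cons !big_nil !mulr1 mulfV // mulr1 mulrA.
Qed.

Lemma multiset_eq_all (e : K) : e^-1 = e -> ms e e -> q12 = q23 /\ q23 = q31.
Proof.
move=> ee /perm_mem h.
have qe q : q \in [:: q12; q23; q31] -> q = e by rewrite h ee !inE !orbb => /eqP.
have e12 : q12 = e by apply: qe; rewrite mem_head.
have e23 : q23 = e by apply: qe; rewrite in_cons mem_head orbT.
have e31 : q31 = e by apply: qe; rewrite 2!in_cons mem_head !orbT.
by rewrite e12 e23 e31.
Qed.

Lemma parameter_cases : exists! i : 'I_6,
  nth False [:: case_i q12 q23 q31; case_ii q12 q23 q31;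
                case_iii q12 q23 q31; case_iv q12 q23 q31;
                case_v q12 q23 q31; case_vi q12 q23 q31] i.
Proof.
have d01 : case_i q12 q23 q31 -> case_ii q12 q23 q31 -> False.
  by move=> [-> _ _] [N1 [/esym/eqP]]; rewrite (negPf N1).
have d02 : case_i q12 q23 q31 -> case_iii q12 q23 q31 -> False.
  by move=> [-> -> ->] [[]].
have d03 : case_i q12 q23 q31 -> case_iv q12 q23 q31 -> False.
  by move=> [-> -> ->] [_ _]; rewrite eqxx.
have d04 : case_i q12 q23 q31 -> case_v q12 q23 q31 -> False.
  by move=> [e1 e2 e3] [c [_ /eqP c1 h]]; apply/c1/(multiset_eq_const h).
have d05 : case_i q12 q23 q31 -> case_vi q12 q23 q31 -> False.
  move=> [e1 e2 e3] [/eqP N1 [c [_ _ /multiset_eq_mem]]]; rewrite e1 e2 e3.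
  by case=> /esym/N1.
have d12 : case_ii q12 q23 q31 -> case_iii q12 q23 q31 -> False.
  by move=> [_ [-> -> ->]] [[]].
have d13 : case_ii q12 q23 q31 -> case_iv q12 q23 q31 -> False.
  by move=> [_ [-> -> ->]] [_ _ _]; rewrite eqxx.
have d14 : case_ii q12 q23 q31 -> case_v q12 q23 q31 -> False.
  move=> [/eqP N1 [e1 e2 e3]] [c [_ _ /multiset_eq_mem]]; rewrite e1 e2 e3.
  by case=> /N1.
have d15 : case_ii q12 q23 q31 -> case_vi q12 q23 q31 -> False.
  by move=> [_ [e1 e2 e3]] [_ [c [_ /eqP c1 h]]]; apply/c1/(multiset_eq_const h).
have d23 : case_iii q12 q23 q31 -> case_iv q12 q23 q31 -> False.
  by move=> [n _] [e1 e2 _ _]; apply: n.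
have d24 : case_iii q12 q23 q31 -> case_v q12 q23 q31 -> False.
  by move=> [_ n] [c [c0 _ h]]; apply: n; exists c => //; left.
have d25 : case_iii q12 q23 q31 -> case_vi q12 q23 q31 -> False.
  by move=> [_ n] [_ [c [c0 _ h]]]; apply: n; exists c => //; right.
have d34 : case_iv q12 q23 q31 -> case_v q12 q23 q31 -> False.
  move=> [e1 e2 /eqP n1 _] [c [_ _ /multiset_eq_mem]]; rewrite -e2 -e1.
  by case=> /n1.
have d35 : case_iv q12 q23 q31 -> case_vi q12 q23 q31 -> False.
  move=> [e1 e2 _ /eqP n1] [_ [c [_ _ /multiset_eq_mem]]]; rewrite -e2 -e1.
  by case=> /n1.
have d45 : case_v q12 q23 q31 -> case_vi q12 q23 q31 -> False.
  move=> [c [c0 _ /(multiset_eq_prod c0) h]] [/eqP N1 [d [d0 _ /(multiset_eq_prod d0)]]].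
  by rewrite h => /esym/N1.
pose P := nth False [:: case_i q12 q23 q31; case_ii q12 q23 q31;
  case_iii q12 q23 q31; case_iv q12 q23 q31; case_v q12 q23 q31; case_vi q12 q23 q31].
suff [i Pi] : exists i : 'I_6, P i.
  exists i; split=> // j; move: Pi; rewrite -/(P j) => Pi Pj; apply: val_inj.
  move: i j Pi Pj => [[|[|[|[|[|[|//]]]]]] li] [[|[|[|[|[|[|//]]]]]] lj] //=;
    rewrite /P /= => h1 h2; exfalso; eauto 3.
have [[e12 e23]|nE] := pselect (q12 = q23 /\ q23 = q31).
  have [e1|n1] := eqVneq q12 1.
    by exists (@Ordinal 6 0 isT); rewrite /P /case_i /= -e23 -e12.
  have [eN1|nN1] := eqVneq q12 (-1).
    by exists (@Ordinal 6 1 isT); rewrite /P /case_ii /= -e23 -e12 eN1 -eN1.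
  by exists (@Ordinal 6 3 isT).
have [[c c0 h]|n1] := pselect (exists2 c, c != 0 & ms 1 c).
  exists (@Ordinal 6 4 isT), c; split=> //.
  apply/eqP => c1; apply: nE; apply: (@multiset_eq_all 1); first exact: invr1.
  by rewrite -{2}c1.
have [[c c0 h]|nN1] := pselect (exists2 c, c != 0 & ms (-1) c).
  exists (@Ordinal 6 5 isT); split.
    (* If -1 were 1, the multiset would be one with 1, already excluded by [n1]. *)
    by apply/eqP => N1; apply: n1; exists c => //; rewrite -N1.
  exists c; split=> //.
  apply/eqP => c1; apply: nE; apply: (@multiset_eq_all (-1)); first exact: invrN1.
  by rewrite -{2}c1.
exists (@Ordinal 6 2 isT); split=> // -[c c0 [] h]; first by apply: n1; exists c.
by apply: nN1; exists c.
Qed.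

End CaseDistinction.

(** * Smaller generating sets of the extension, and the theorem *)

Section GeneratedByParameters.
Variables (k K : fieldType) (iota : {rmorphism k -> K}) (q12 q13 q23 : K).
Hypothesis K_gen : generated_field iota [:: q12; q13; q23].

Lemma generated_parameters (t : seq K) :
    (forall S : {pred K}, GRing.divring_closed S -> {in t, forall x, x \in S} ->
      [/\ q12 \in S, q23 \in S & q13^-1 \in S]) ->
  generated_field iota t.
Proof.
move=> sub; apply: generated_field_sub K_gen _ => S clS _ tS x.
have [S12 S23 S31] := sub S clS tS; have [S1 _ SV] := clS.
rewrite !inE => /or3P[] /eqP-> //.
by rewrite -[q13]invrK -[_^-1]mul1r SV.
Qed.

Lemma divring_closed_pm1 (S : {pred K}) : GRing.divring_closed S ->
  [/\ 1 \in S, -1 \in S & forall x, x \in S -> x^-1 \in S].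
Proof.
move=> [S1 SB SV]; split=> // [|x Sx]; last by rewrite -[x^-1]mul1r SV.
by rewrite -sub0r SB // -(subrr 1) SB.
Qed.

Lemma trdeg_multiset (e c : K) : e = 1 \/ e = -1 ->
  multiset_eq q12 q23 q13^-1 e c -> trdeg_le iota 1.
Proof.
move=> e1 /perm_mem h; apply: (@trdeg_le_generated _ _ _ [:: c]).
apply: generated_parameters => S /divring_closed_pm1[S1 SN1 SV] cS.
have Sc : c \in S by apply: cS; rewrite inE.
have Sq q : q \in [:: q12; q23; q13^-1] -> q \in S.
  rewrite h !inE => /or3P[] /eqP->; [by case: e1 => -> | by [] | exact: SV].
by split; apply: Sq; rewrite !inE eqxx ?orbT.
Qed.

End GeneratedByParameters.

Theorem theorem11p1 (k K : fieldType) (iota : {rmorphism k -> K})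
    (q12 q13 q23 : K) (q12_neq0 : q12 != 0) (q13_neq0 : q13 != 0)
    (q23_neq0 : q23 != 0) (K_gen : generated_field iota [:: q12; q13; q23]) :
  let q31 := q13^-1 in
  let Aut := AutSQ q12 q23 q31 in
  (exists! i : 'I_6,
    nth False [:: case_i q12 q23 q31; case_ii q12 q23 q31;
                  case_iii q12 q23 q31; case_iv q12 q23 q31;
                  case_v q12 q23 q31; case_vi q12 q23 q31] i) /\
  (case_i q12 q23 q31 ->
    [/\ Aut = [set map_mx iota N | N in GLset k],
        trivial_ext iota & is_trdeg iota 0]) /\
  (case_ii q12 q23 q31 ->
    [/\ Aut = [set map_mx iota N | N in GLset k `&` monomial_set k],
        trivial_ext iota & is_trdeg iota 0]) /\
  (case_iii q12 q23 q31 -> Aut = torus K /\ trdeg_le iota 3) /\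
  (case_iv q12 q23 q31 ->
    trdeg_le iota 1 /\
    Aut = generated (GLset K `&`
      ([set M | exists a12 a23 a31, M = mx3 0   a12 0
                                            0   0   a23
                                            a31 0   0] `|`
       [set M | exists a13 a21 a32, M = mx3 0   0   a13
                                            a21 0   0
                                            0   a32 0]))) /\
  (case_v q12 q23 q31 ->
    [/\ trdeg_le iota 1,
        [\/ q23 = 1 /\ (q12 = q31^-1 /\ q12 <> 1),
            q31 = 1 /\ (q12 = q23^-1 /\ q12 <> 1)
          | q12 = 1 /\ (q23 = q31^-1 /\ q23 <> 1)]
      & [/\ q23 = 1 /\ (q12 = q31^-1 /\ q12 <> 1) ->
              Aut = GLset K `&`
                [set M | exists a11 a22 a23 a32 a33, M = mx3 a11 0   0
                                                             0   a22 a23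
                                                             0   a32 a33],
            q31 = 1 /\ (q12 = q23^-1 /\ q12 <> 1) ->
              Aut = GLset K `&`
                [set M | exists a11 a13 a22 a31 a33, M = mx3 a11 0   a13
                                                             0   a22 0
                                                             a31 0   a33]
          & q12 = 1 /\ (q23 = q31^-1 /\ q23 <> 1) ->
              Aut = GLset K `&`
                [set M | exists a11 a12 a21 a22 a33, M = mx3 a11 a12 0
                                                             a21 a22 0
                                                             0   0   a33]]]) /\
  (case_vi q12 q23 q31 ->
    [/\ trdeg_le iota 1,
        [\/ q23 = -1 /\ q12 = q31^-1,
            q31 = -1 /\ q12 = q23^-1
          | q12 = -1 /\ q31^-1 = q23]
      & [/\ q23 = -1 /\ q12 = q31^-1 ->
              Aut = generated (torus K `|` (GLset K `&`
                [set M | exists a11 a23 a32, M = mx3 a11 0   0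
                                                     0   0   a23
                                                     0   a32 0])),
            q31 = -1 /\ q12 = q23^-1 ->
              Aut = generated (torus K `|` (GLset K `&`
                [set M | exists a13 a22 a31, M = mx3 0   0   a13
                                                     0   a22 0
                                                     a31 0   0]))
          & q12 = -1 /\ q31^-1 = q23 ->
              Aut = generated (torus K `|` (GLset K `&`
                [set M | exists a12 a21 a33, M = mx3 0   a12 0
                                                     a21 0   0
                                                     0   0   a33]))]]).
Proof.
move=> q31 Aut; have q31_neq0 : q31 != 0 by rewrite invr_eq0.
have trivial_pm1 (e : K) : e = 1 \/ e = -1 -> q12 = e -> q23 = e -> q31 = e ->
    generated_field iota [::].
  move=> e1 h1 h2 h3; apply: (generated_parameters K_gen).
  move=> S /divring_closed_pm1[S1 SN1 _] _; rewrite h1 h2 -/q31 h3.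
  by case: e1 => ->.
have lift_GL (M : 'M[K]_3) : trivial_ext iota -> M \in unitmx ->
    exists2 N, N \in unitmx & map_mx iota N = M.
  move=> /choice[g gK] uM.
  have MN : map_mx iota (map_mx g M) = M by apply/matrixP => i j; rewrite !mxE.
  by exists (map_mx g M); rewrite // -(map_unitmx iota) MN.
have monomial_map N : monomial_set K (map_mx iota N) <-> monomial_set k N.
  pose F (P : 'I_3 -> 'I_3 -> bool) : Prop :=
    (forall i, exists! j, P i j) /\ (forall j, exists! i, P i j).
  suff E : (fun i j => map_mx iota N i j != 0) = (fun i j => N i j != 0).
    by rewrite -[monomial_set k N]/(F (fun i j => N i j != 0)) -E.
  by apply/funext => i; apply/funext => j; rewrite mxE fmorph_eq0.
split; first exact: parameter_cases.
split=> [ci|].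
  have [h1 h2 h3] := ci; have gen := trivial_pm1 1 (or_introl erefl) h1 h2 h3.
  have triv := generated_field_nil_trivial gen.
  split=> //; last exact: trdeg_trivial.
  rewrite /Aut AutSQ_case_i //; apply/seteqP; split=> M; first exact: lift_GL.
  by move=> [N uN <-]; rewrite /GLset /= map_unitmx.
split=> [cii|].
  have [_ [h1 h2 h3]] := cii.
  have gen := trivial_pm1 (-1) (or_intror erefl) h1 h2 h3.
  have triv := generated_field_nil_trivial gen.
  split=> //; last exact: trdeg_trivial.
  rewrite /Aut AutSQ_case_ii //; apply/seteqP; split=> M.
    move=> [/(lift_GL M triv)[N uN <-]] /monomial_map mN.
    by exists N.
  by move=> [N [uN /monomial_map mN] <-]; split=> //; rewrite /GLset /= map_unitmx.
split=> [ciii|].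
  split; first exact: AutSQ_case_iii.
  exact: (trdeg_le_generated K_gen).
split=> [civ|].
  split; last exact: AutSQ_case_iv.
  have [h1 h2 _ _] := civ; apply: (@trdeg_le_generated _ _ _ [:: q12]).
  apply: (generated_parameters K_gen) => S _ S12.
  by rewrite -/q31 -h2 -h1; split; apply: S12; rewrite inE.
split=> [[c [c0 c1 h]]|[N1 [c [c0 c1 h]]]].
  have trd : trdeg_le iota 1.
    by apply: (trdeg_multiset K_gen) h; left.
  have alts := (multiset_eqP q31 q12_neq0 q23_neq0 1).1
    (ex_intro2 _ _ c c0 h).
  (* If a parameter of the mutually inverse pair were 1, so would be its partner, hence all three,
     and then [c] too. *)
  have n_all : ~ [/\ q12 = 1, q23 = 1 & q31 = 1].
    by move=> [h1 h2 h3]; case/eqP: c1; apply: multiset_eq_const h _ _ _.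
  split=> //; last first.
    split=> -[e1 [e2 e3]].
    - exact: AutSQ_case_v_a.
    - exact: AutSQ_case_v_b.
    - exact: AutSQ_case_v_c.
  case: alts => -[e1 e2]; [constructor 1|constructor 2|constructor 3];
    do 2 split=> //; move=> e3; apply: n_all; split=> //.
  - by rewrite -[q31]invrK -e2 e3 invr1.
  - by rewrite -[q23]invrK -e2 e3 invr1.
  - by rewrite -[q31]invrK -e2 e3 invr1.
have trd : trdeg_le iota 1.
  by apply: (trdeg_multiset K_gen) h; right.
have alts := (multiset_eqP q31 q12_neq0 q23_neq0 (-1)).1
  (ex_intro2 _ _ c c0 h).
(* Supplies the inequality with -1 that the lemmas for the three subcases require. *)
have n_all : ~ [/\ q12 = -1, q23 = -1 & q31 = -1].
  by move=> [h1 h2 h3]; case/eqP: c1; apply: multiset_eq_const h _ _ _.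
split=> //.
  case: alts => -[e1 e2]; [constructor 1|constructor 2|constructor 3] => //.
split=> -[e1 e2].
- apply: AutSQ_case_vi_a => // e3; apply: n_all; split=> //.
  by rewrite -[q31]invrK -e2 e3 invrN1.
- apply: AutSQ_case_vi_b => // e3; apply: n_all; split=> //.
  by rewrite -[q23]invrK -e2 e3 invrN1.
- apply: AutSQ_case_vi_c => // e3; apply: n_all; split=> //.
  by rewrite -[q31]invrK e2 e3 invrN1.
Qed.
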